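(* The Bargmann space $\mathbb{B}$ is a reproducing kernel Hilbert space on $\mathbb{C}$ with reproducing kernel $K(z,w)=e^{z\overline{w}}$; i.e., for every $\varphi\in\mathbb{B}$ and every $z\in\mathbb{C}$, $\varphi(z)=\langle\varphi,K(\cdot,z)\rangle_{\mathbb{B}}$.
   Context: The Bargmann space $\mathbb{B}$ is the space of entire functions $\varphi:\mathbb{C}\to\mathbb{C}$ with $\int_{\mathbb{C}}|\varphi(z)|^2e^{-|z|^2}dx\,dy<\infty$ and inner product $\langle\varphi,\psi\rangle_{\mathbb{B}}=\frac1\pi\int_{\mathbb{C}}\varphi(z)\overline{\psi(z)}e^{-|z|^2}dx\,dy$. A reproducing kernel Hilbert space on a set $E$ is a Hilbert space $\mathcal{H}$ of functions $E\to\mathbb{C}$ for which every evaluation $\varphi\mapsto\varphi(z)$, $z\in E$, is bounded; its reproducing kernel is $K(z,w)=k_w(z)$, where $k_w\in\mathcal{H}$ is the element with $\varphi(w)=\langle\varphi,k_w\rangle$ for all $\varphi\in\mathcal{H}$. *)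

(* Defs.v *)
From HB Require Import structures.
From mathcomp Require Import all_boot all_order all_algebra.
From mathcomp Require Import complex.
From mathcomp Require Import all_classical all_reals all_analysis.
Import Order.TTheory GRing.Theory Num.Theory.
Import numFieldNormedType.Exports.

Set Implicit Arguments.
Unset Strict Implicit.
Unset Printing Implicit Defensive.

Local Open Scope classical_set_scope.
Local Open Scope ring_scope.
Local Open Scope complex_scope.

(* `|z| lives in R[i] and is (normc z)%:C; inequalities and integrals need the
   modulus as an element of R. *)
Local Notation normc := ComplexField.Normc.normc.

(* Euler's formula, e^(x + iy) = e^x (cos y + i sin y) *)
Definition cexp (R : realType) (z : R[i]) : R[i] :=
  (expR (complex.Re z) * cos (complex.Im z)) +i*
  (expR (complex.Re z) * sin (complex.Im z)).

Section FunctionSpaces.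
Variables (R : realType) (E : Type).

(* A space of functions is a set H together with a pairing ip on all of
   E -> R[i], of which only the values on H matter. *)
Implicit Types (H : set (E -> R[i])) (ip : (E -> R[i]) -> (E -> R[i]) -> R[i]).

Record is_subspace H : Prop := {
  subspace0 : H (fun=> 0);
  subspaceD : forall f g, H f -> H g -> H (fun x => f x + g x);
  subspaceZ : forall (a : R[i]) f, H f -> H (fun x => a * f x)
}.

(* Linear in the first argument.  In R[i], 0 <= z says that z is real and
   nonnegative. *)
Record is_inner_product H ip : Prop := {
  ip_Dl : forall f g h, H f -> H g -> H h ->
    ip (fun x => f x + g x) h = ip f h + ip g h;
  ip_Zl : forall (a : R[i]) f h, H f -> H h ->
    ip (fun x => a * f x) h = a * ip f h;
  ip_herm : forall f g, H f -> H g -> ip g f = conjc (ip f g);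
  ip_ge0 : forall f, H f -> 0 <= ip f f;
  ip_definite : forall f, H f -> ip f f = 0 -> f = (fun=> 0)
}.

Definition ip_norm ip (f : E -> R[i]) : R := Num.sqrt (complex.Re (ip f f)).

Definition ip_cauchy ip (u : nat -> E -> R[i]) : Prop :=
  forall e : R, 0 < e -> exists N : nat, forall m n : nat,
    (N <= m)%N -> (N <= n)%N -> ip_norm ip (fun x => u m x - u n x) < e.

Definition ip_converges ip (u : nat -> E -> R[i]) (f : E -> R[i]) : Prop :=
  (fun n => ip_norm ip (fun x => u n x - f x)) @ \oo --> (0 : R).

Definition ip_complete H ip : Prop :=
  forall u : nat -> E -> R[i], (forall n, H (u n)) -> ip_cauchy ip u ->
    exists2 f, H f & ip_converges ip u f.

Record is_hilbert H ip : Prop := {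
  hilbert_subspace : is_subspace H;
  hilbert_ip : is_inner_product H ip;
  hilbert_complete : ip_complete H ip
}.

Definition bounded_evaluation H ip (z : E) : Prop :=
  exists M : R, forall f, H f -> normc (f z) <= M * ip_norm ip f.

Record is_rkhs H ip : Prop := {
  rkhs_hilbert : is_hilbert H ip;
  rkhs_bounded : forall z, bounded_evaluation H ip z
}.

Definition is_reproducing_kernel H ip (K : E -> E -> R[i]) : Prop :=
  forall w, H (K^~ w) /\ (forall f, H f -> f w = ip f (K^~ w)).

End FunctionSpaces.

Section Bargmann.
Variable R : realType.

(* The ascription R[i]^o makes the scalar field R[i], so that this is complex
   differentiability: the increments range over R[i]. *)
Definition entire (f : R[i] -> R[i]) : Prop :=
  forall z : R[i], derivable (f : R[i]^o -> R[i]^o) z 1.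

Definition lebesgue2 := (@lebesgue_measure R \x @lebesgue_measure R)%E.

Definition plane_integral (g : R[i] -> R[i]) : R[i] :=
  (\int[lebesgue2]_p complex.Re (g (p.1 +i* p.2))) +i*
  (\int[lebesgue2]_p complex.Im (g (p.1 +i* p.2))).

Definition gauss_weight (z : R[i]) : R := expR (- normc z ^+ 2).

Definition bargmann : set (R[i] -> R[i]) :=
  [set phi | entire phi /\
    (\int[lebesgue2]_p
       (normc (phi (p.1 +i* p.2)) ^+ 2 * gauss_weight (p.1 +i* p.2))%:E
     < +oo)%E].

Definition bargmann_ip (phi psi : R[i] -> R[i]) : R[i] :=
  (pi^-1 : R)%:C *
  plane_integral (fun z => phi z * conjc (psi z) * (gauss_weight z)%:C).

End Bargmann.

(* Main.v *)
Require Import Defs.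
From HB Require Import structures.
From mathcomp Require Import all_boot all_order all_algebra.
From mathcomp Require Import complex ring lra.
From mathcomp Require Import all_classical all_reals all_analysis.
From mathcomp Require Import measurable_realfun.
Import Order.TTheory GRing.Theory Num.Theory.
Import numFieldNormedType.Exports.
Set Implicit Arguments.
Unset Strict Implicit.
Unset Printing Implicit Defensive.
Local Open Scope classical_set_scope.
Local Open Scope ring_scope.
Local Open Scope complex_scope.
Local Notation normc := ComplexField.Normc.normc.

(* Mean value property: by Goursat's bisection argument, applied to the entire
   function s + i t |-> g (u e^(s + i t)), the integral of g (u e^(s + i t)) over
   0 <= t <= 2 pi does not depend on s; letting s tend to -oo it is 2 pi g 0.
   Lebesgue measure on the plane is invariant under rotations (products of three
   shears), so averaging over rotations and Fubini give
     int g(z) e^(-|z|^2) = pi g(0)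
   for entire g whose weighted integral converges.  Applied to
   g(u) = f(u + w) e^(-u w^* ), a translation turns this into f w = <f, K(., w)>.

   By Cauchy-Schwarz the evaluations are then bounded, so a Cauchy sequence in the
   Bargmann space converges pointwise, and by Fatou in norm, to a Gaussian square
   integrable F with F w = <F, K(., w)>.  Such an F is entire because w |-> K(., w)
   is antiholomorphic with values in L2, so no Weierstrass theorem is needed. *)

(** * Complex modulus, exponential and derivative *)

Section ComplexModulus.
Variable R : realType.
Implicit Types z w : R[i].

(** Entire means complex differentiable at each point, with nothing assumed on the derivative, so
    neither Green's formula nor differentiation under the integral sign is at hand; this is what
    imposes the bisection. The substitution z = u e^(s + i t) makes rectangles enough: circles about
    0 become vertical segments, and the period 2 pi makes the horizontal sides cancel. The kernel is
    dictated by the weight: after the translation, the conjugate of K(u + w, w) times e^(-|u + w|^2)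
    is e^(-u conj w) e^(-|u|^2), so all that depends on conj u is gathered in the Gaussian.
    Completeness is run in the larger space of measurable square integrable functions, where the
    pairing is only positive semidefinite, because a limit has a norm before it is known to be
    entire. There Cauchy-Schwarz with an extra factor 2 suffices, as only finiteness of bounds and
    convergence to 0 are used. *)

Lemma normc_ge0 z : 0 <= normc z.
Proof. by case: z => a b; rewrite /= sqrtr_ge0. Qed.

Lemma normC_normc z : `|z| = (normc z)%:C.
Proof. by []. Qed.

Lemma normc_sqr z : normc z ^+ 2 = complex.Re z ^+ 2 + complex.Im z ^+ 2.
Proof. by case: z => a b; rewrite /= sqr_sqrtr// addr_ge0// sqr_ge0. Qed.

Lemma normcR (a : R) : normc a%:C = `|a|.
Proof. by rewrite /= expr0n addr0 sqrtr_sqr. Qed.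

Lemma ler_normcD z w : normc (z + w) <= normc z + normc w.
Proof. exact: le_normcD. Qed.

Lemma normcN z : normc (- z) = normc z.
Proof. exact: normcN. Qed.

Lemma normcB z w : normc (z - w) = normc (w - z).
Proof. by rewrite -normcN opprB. Qed.

Lemma Re_le_normc z : `|complex.Re z| <= normc z.
Proof.
rewrite -ler_sqr ?nnegrE ?normc_ge0//.
by rewrite real_normK ?num_real// normc_sqr lerDl sqr_ge0.
Qed.

Lemma Im_le_normc z : `|complex.Im z| <= normc z.
Proof.
rewrite -ler_sqr ?nnegrE ?normc_ge0//.
by rewrite real_normK ?num_real// normc_sqr lerDr sqr_ge0.
Qed.

Lemma normc_le_ReIm z : normc z <= `|complex.Re z| + `|complex.Im z|.
Proof.
have h : 0 <= `|complex.Re z| + `|complex.Im z| by rewrite addr_ge0.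
rewrite -ler_sqr ?nnegrE ?normc_ge0// normc_sqr sqrrD !real_normK ?num_real//.
by rewrite addrAC lerDl mulrn_wge0// mulr_ge0.
Qed.

Lemma normc_conj z : normc (conjc z) = normc z.
Proof. by case: z => a b /=; rewrite sqrrN. Qed.

Lemma mulc_conj z : z * conjc z = (normc z ^+ 2)%:C.
Proof. by rewrite normc_sqr; case: z => a b; simpc; congr (_ +i* _); ring. Qed.

Lemma ReD z w : complex.Re (z + w) = complex.Re z + complex.Re w.
Proof. by case: z w => ? ? []. Qed.
Lemma ImD z w : complex.Im (z + w) = complex.Im z + complex.Im w.
Proof. by case: z w => ? ? []. Qed.
Lemma ReB z w : complex.Re (z - w) = complex.Re z - complex.Re w.
Proof. by case: z w => ? ? []. Qed.
Lemma ImB z w : complex.Im (z - w) = complex.Im z - complex.Im w.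
Proof. by case: z w => ? ? []. Qed.
Lemma ReM z w :
  complex.Re (z * w) = complex.Re z * complex.Re w - complex.Im z * complex.Im w.
Proof. by case: z w => ? ? []. Qed.
Lemma ImM z w :
  complex.Im (z * w) = complex.Re z * complex.Im w + complex.Im z * complex.Re w.
Proof. by case: z w => ? ? []. Qed.

Lemma cexpD z w : cexp (z + w) = cexp z * cexp w.
Proof.
case: z w => a b [c d]; rewrite /cexp /= expRD cosD sinD; simpc.
by congr (_ +i* _); ring.
Qed.

Lemma cexp0 : cexp (0 : R[i]) = 1.
Proof. by rewrite /cexp /= expR0 cos0 sin0 mulr1 mulr0. Qed.

Lemma normc_cexp z : normc (cexp z) = expR (complex.Re z).
Proof.
apply/eqP; rewrite -(@eqrXn2 _ 2) ?normc_ge0 ?expR_ge0//.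
by rewrite normc_sqr /= !exprMn -mulrDr cos2Dsin2 mulr1.
Qed.

Lemma conj_cexp z : conjc (cexp z) = cexp (conjc z).
Proof. by case: z => a b; rewrite /cexp /= cosN sinN mulrN. Qed.

End ComplexModulus.

(** * Second-order remainder of the complex exponential *)

Section ExponentialEstimates.
Variable R : realType.

(** All comes from 1 + t <= e^t: at t = -y, multiplied by e^y, it gives e^y - 1 <= y e^y, which
    settles x >= 0. *)
Lemma expR_sub1_le (x : R) : `|expR x - 1| <= `|x| * expR `|x|.
Proof.
have h (y : R) : expR y - 1 <= y * expR y.
  have := expR_ge1Dx (- y); rewrite -(ler_pM2l (expR_gt0 y)) -expRD subrr expR0.
  by lra.
have [x0|x0] := leP 0 x.
  by rewrite (ger0_norm x0) ger0_norm ?h// subr_ge0 -expR0 ler_expR.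
rewrite (ltr0_norm x0) ler0_norm; last by rewrite subr_le0 -expR0 ler_expR ltW.
rewrite opprB; have := expR_ge1Dx x => h1.
have : - x <= - x * expR (- x).
  by rewrite ler_peMr ?oppr_ge0 ?ltW// -expR0 ltr_expR oppr_gt0.
by move=> /(le_trans _); apply; lra.
Qed.

Lemma expR_sub1x_le (x : R) : `|expR x - 1 - x| <= x ^+ 2 * expR `|x|.
Proof.
have h0 := expR_ge1Dx x.
have hx := expR_ge1Dx (- x).
have h1 : expR x - 1 <= x * expR x.
  move: hx; rewrite -(ler_pM2l (expR_gt0 x)) -expRD subrr expR0; lra.
rewrite ger0_norm; last lra.
apply: (@le_trans _ _ (`|x| * (`|x| * expR `|x|))); last first.
  by rewrite mulrA -expr2 real_normK ?num_real.
apply: (@le_trans _ _ (x * (expR x - 1))); first lra.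
rewrite (le_trans (ler_norm _))// normrM ler_wpM2l//.
exact: expR_sub1_le.
Qed.

(** Mean value inequality at 0. The bound on [df] is asked only for |x| <= |y|, so B may depend on
    y: this lets each estimate for sine and cosine feed the next. *)
Lemma derive_bound0 (f df : R -> R) (B y : R) :
  (forall x : R, is_derive x 1 f (df x)) -> f 0 = 0 ->
  (forall x, `|x| <= `|y| -> `|df x| <= B) -> `|f y| <= B * `|y|.
Proof.
move=> fd f0 dB.
have cf : continuous f.
  by move=> x; apply: differentiable_continuous; apply/derivable1_diffP; apply: ex_derive.
have [y0|y0] := leP 0 y.
  have [|c /[!in_itv]/= /andP[c0 cy]] := @MVT_segment _ f df _ _ y0 (fun x _ => fd x).
    exact: continuous_subspaceT.
  rewrite f0 !subr0 => ->; rewrite normrM ler_wpM2r// dB//.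
  by rewrite !ger0_norm.
have [|c /[!in_itv]/= /andP[c0 cy]] := @MVT_segment _ f df _ _ (ltW y0) (fun x _ => fd x).
  exact: continuous_subspaceT.
rewrite f0 !sub0r => /(congr1 Num.norm); rewrite normrN normrM normrN => ->.
by rewrite ler_wpM2r// dB// !ler0_norm ?(ltW y0)// lerN2.
Qed.

Lemma sin_le (y : R) : `|sin y| <= `|y|.
Proof.
rewrite -[leRHS]mul1r; apply: (@derive_bound0 sin cos); first exact: sin0.
by move=> x _; rewrite ler_norml cos_geN1 cos_le1.
Qed.

Lemma is_derive_cos_sub1 (x : R) : is_derive x 1 (fun x => cos x - 1) (- sin x).
Proof. by rewrite -[- sin x]subr0; apply: is_deriveB. Qed.

Lemma cos_sub1_le (y : R) : `|cos y - 1| <= y ^+ 2.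
Proof.
rewrite -[y ^+ 2]real_normK ?num_real// expr2.
apply: (derive_bound0 is_derive_cos_sub1); first by rewrite cos0 subrr.
by move=> x xy; rewrite normrN (le_trans (sin_le _)).
Qed.

Lemma cos_sub1_le1 (y : R) : `|cos y - 1| <= `|y|.
Proof.
rewrite -[leRHS]mul1r.
apply: (derive_bound0 is_derive_cos_sub1); first by rewrite cos0 subrr.
by move=> x xy; rewrite normrN ler_norml sin_geN1 sin_le1.
Qed.

Lemma sin_sub_le (y : R) : `|sin y - y| <= y ^+ 2.
Proof.
rewrite -[y ^+ 2]real_normK ?num_real// expr2.
have d (x : R) : is_derive x 1 (fun x => sin x - x) (cos x - 1) by apply: is_deriveB.
apply: (derive_bound0 d); first by rewrite sin0 subrr.
by move=> x xy; rewrite (le_trans (cos_sub1_le1 _)).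
Qed.

(** The factor 4 counts two error terms in the real part and two in the imaginary part, each at most
    |z|^2 e^|z|. The crude exponential makes the bound valid for all z, as the kernel estimate
    requires. *)
Lemma cexp_sub1z_le (z : R[i]) :
  normc (cexp z - 1 - z) <= 4 * normc z ^+ 2 * expR (normc z).
Proof.
have := normc_sqr z; have := Re_le_normc z; have := Im_le_normc z.
set N := normc z; set x := complex.Re z; set y := complex.Im z => Hy Hx HN.
have N0 : 0 <= N := normc_ge0 _.
have xx : x ^+ 2 <= N ^+ 2 by rewrite HN lerDl sqr_ge0.
have yy : y ^+ 2 <= N ^+ 2 by rewrite HN lerDr sqr_ge0.
have eN : expR `|x| <= expR N by rewrite ler_expR.
have eN0 := expR_gt0 N.
apply: (le_trans (normc_le_ReIm _)).
have -> : cexp z - 1 - z = (expR x * cos y - 1 - x) +i* (expR x * sin y - 0 - y).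
  by rewrite /x /y; case: (z).
rewrite [complex.Re _]/= [complex.Im _]/=.
have -> : 4 * N ^+ 2 * expR N = (N ^+ 2 * expR N + N ^+ 2 * expR N)
    + (N ^+ 2 * expR N + N ^+ 2 * expR N) by ring.
have bx : `|expR x| <= expR N.
  by rewrite ger0_norm ?expR_ge0// ler_expR (le_trans (ler_norm _)).
apply: lerD.
  have -> : expR x * cos y - 1 - x = (expR x - 1 - x) + expR x * (cos y - 1) by ring.
  rewrite (le_trans (ler_normD _ _))// lerD//.
    by rewrite (le_trans (expR_sub1x_le _))// ler_pM ?sqr_ge0 ?expR_ge0.
  by rewrite normrM mulrC ler_pM// (le_trans (cos_sub1_le _)).
have -> : expR x * sin y - 0 - y = expR x * (sin y - y) + y * (expR x - 1) by ring.
rewrite (le_trans (ler_normD _ _))// lerD//.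
  by rewrite normrM mulrC ler_pM// (le_trans (sin_sub_le _)).
rewrite normrM expr2 -mulrA ler_pM// (le_trans (expR_sub1_le _))//.
by rewrite ler_pM ?expR_ge0.
Qed.

End ExponentialEstimates.

(** * Complex differentiability and entire functions *)

Section ComplexDerivative.
Variable R : realType.
Implicit Types (f g : R[i] -> R[i]) (z w : R[i]).

(** Real e and d and no quotient: the increment h = 0 is allowed, and errors are bounded by
    multiplying moduli. *)
Definition cdiff f z (D : R[i]) := forall e : R, 0 < e ->
  exists2 d : R, 0 < d & forall h : R[i], normc h < d ->
    normc (f (z + h) - f z - D * h) <= e * normc h.

Lemma derivable_cdiff f z :
  derivable (f : R[i]^o -> R[i]^o) z 1 -> exists D, cdiff f z D.
Proof.
move=> /cvg_ex[D /cvgrPdist_lt fD]; exists D => e e0; move: fD.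
move=> /(_ e%:C); rewrite ltcR => /(_ e0).
rewrite near_withinE => /nbhs_ballP[d /= d0 hd].
(* Positive elements of R[i] are real, so the radius is the embedding of its real part. *)
have dE : d = (complex.Re d)%:C.
  by move: d0; case: (d) => a b /=; rewrite ltcE /= => /andP[/eqP->].
exists (complex.Re d); first by move: d0; rewrite dE ltcR.
move=> h hlt; have [->|h0] := eqVneq h 0.
  by rewrite addr0 subrr mulr0 subr0 Normc.normc0 mulr0.
have := hd h; rewrite /ball /= sub0r normrN normC_normc dE ltcR => /(_ hlt h0).
rewrite normC_normc ltcR => hh.
have -> : f (z + h) - f z - D * h = - (D - h^-1 *: (f (h *: (1 : R[i]^o) + z) - f z)) * h.
  rewrite /GRing.scale /= mulr1 [h + z]addrC mulNr mulrBl mulrAC mulVf// mul1r; ring.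
by rewrite Normc.normcM normcN ler_wpM2r ?normc_ge0 ?ltW.
Qed.

Lemma cdiff_derivable f z D :
  cdiff f z D -> derivable (f : R[i]^o -> R[i]^o) z 1.
Proof.
move=> fD; apply/cvg_ex; exists (D : R[i]^o); apply/cvgrPdist_le => e e0.
have eE : e = (complex.Re e)%:C.
  by move: e0; case: (e) => a b /=; rewrite ltcE /= => /andP[/eqP->].
have [|d d0 hd] := fD (complex.Re e); first by move: e0; rewrite {1}eE ltcR.
rewrite near_withinE; apply/nbhs_ballP; exists d%:C; first by rewrite /= ltcR.
move=> h; rewrite /ball /= sub0r normrN normC_normc ltcR => hlt h0.
rewrite normC_normc eE lecR.
have -> : D - h^-1 *: (f (h *: (1 : R[i]^o) + z) - f z) = - (f (z + h) - f z - D * h) / h.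
  rewrite /GRing.scale /= mulr1 [h + z]addrC mulNr mulrBl mulfK//; ring.
rewrite Normc.normcM normcN Normc.normcV ler_pdivrMr ?hd//.
rewrite lt_neqAle normc_ge0 andbT eq_sym; apply/eqP => /Normc.eq0_normc.
by apply/eqP.
Qed.

Lemma entire_cexp : entire (@cexp R).
Proof.
move=> z; apply: (@cdiff_derivable _ _ (cexp z)) => e e0.
(* For |h| < 1 the remainder of [cexp] at h is at most 4 e |h|^2, and [cexp z] has modulus e^(Re
   z). *)
pose M := expR (complex.Re z) * 4 * expR 1.
have M0 : 0 < M by rewrite /M !mulr_gt0 ?expR_gt0.
exists (Num.min 1 (e / M)); first by rewrite lt_min ltr01 divr_gt0.
move=> h; rewrite lt_min => /andP[h1 hM].
have -> : cexp (z + h) - cexp z - cexp z * h = cexp z * (cexp h - 1 - h).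
  by rewrite cexpD; ring.
rewrite Normc.normcM normc_cexp.
apply: (@le_trans _ _ (M * normc h * normc h)); last first.
  by rewrite ler_wpM2r ?normc_ge0// mulrC -ler_pdivlMr// ltW.
have -> : M * normc h * normc h = expR (complex.Re z) * (4 * normc h ^+ 2 * expR 1).
  by rewrite /M; ring.
rewrite ler_pM2l ?expR_gt0// (le_trans (cexp_sub1z_le _))// ler_wpM2l//.
  by rewrite mulr_ge0// sqr_ge0.
by rewrite ler_expR ltW.
Qed.

Lemma entireD f g : entire f -> entire g -> entire (fun z => f z + g z).
Proof. by move=> ef eg z; exact: (@derivableD _ _ _ (f : R[i]^o -> R[i]^o) g). Qed.

Lemma entireM f g : entire f -> entire g -> entire (fun z => f z * g z).
Proof. by move=> ef eg z; exact: (@derivableM _ _ (f : R[i]^o -> R[i]^o) g). Qed.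

Lemma entire_cst (a : R[i]) : entire (fun=> a).
Proof. by move=> z; exact: (@derivable_cst _ _ _ (a : R[i]^o)). Qed.

Lemma entire_id : entire (fun z : R[i] => z).
Proof. by move=> z; exact: derivable_id. Qed.

Lemma entire_comp f g : entire f -> entire g -> entire (fun z => f (g z)).
Proof.
move=> ef eg z; apply/derivable1_diffP.
apply: (@differentiable_comp _ _ _ _ (g : R[i]^o -> R[i]^o) (f : R[i]^o -> R[i]^o)).
  exact/derivable1_diffP.
exact/derivable1_diffP.
Qed.

Lemma entire_cont f z (e : R) : entire f -> 0 < e ->
  exists2 d : R, 0 < d & forall w, normc (w - z) < d -> normc (f w - f z) < e.
Proof.
move=> /(_ z) /derivable_cdiff[D /(_ 1 ltr01)[d d0 hd]] e0.
pose K := 1 + normc D.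
have K0 : 0 < K by rewrite /K ltr_pwDl// normc_ge0.
exists (Num.min d (e / K)); first by rewrite lt_min d0 divr_gt0.
move=> w; rewrite lt_min => /andP[/hd + wK].
rewrite [z + _]addrC subrK => h.
have -> : f w - f z = (f w - f z - D * (w - z)) + D * (w - z) by ring.
apply: (le_lt_trans (ler_normcD _ _)).
rewrite Normc.normcM; apply: (@le_lt_trans _ _ (K * normc (w - z))).
  by rewrite /K mulrDl lerD2r.
by rewrite mulrC -ltr_pdivlMr.
Qed.

End ComplexDerivative.

(** * Area-preserving maps of the plane *)

Section PlaneMeasure.
Variable R : realType.
Local Notation mu := (@lebesgue_measure R).
Local Notation mR := (measurableTypeR R).

(** The sigma-algebra on the plane is the product one, generated by measurable rectangles, so an
    open preimage has to be exhibited as a countable union of rectangles: squares with rational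
    centre and radius 1/(n + 1). *)
Lemma measurable_fun_continuous2 (f : R * R -> R) :
  continuous f -> measurable_fun [set: mR * mR] (f : mR * mR -> mR).
Proof.
move=> cf; apply: (measurability _ (measurable_realfun.RGenOpens.measurableE R)) => //.
move=> _ [_ [a [b ->] <-]]; rewrite setTI.
pose B (q : rat * rat) (n : nat) : set (mR * mR) :=
  ball (ratr q.1 : R) n.+1%:R^-1 `*` ball (ratr q.2 : R) n.+1%:R^-1.
have oV : open (f @^-1` `]a, b[) by apply: open_comp => [x _|]; [exact: cf|exact: interval_open].
(* Squares that leave the open set are replaced by the empty set, so that the union runs over all
   indices. *)
pose G (q : rat * rat) (n : nat) := if `[< B q n `<=` f @^-1` `]a, b[ >] then B q n else set0.
have -> : f @^-1` `]a, b[ = \bigcup_q1 \bigcup_q2 \bigcup_n G (q1, q2) n.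
  apply/seteqP; split => [[x y] Vxy|p [q1 _ [q2 _ [n _]]]]; last first.
    by rewrite /G; case: asboolP => // BV /BV.
  have := oV (x, y) Vxy => /nbhs_ballP[e /= e0 he].
  (* Two radii: from (x, y) to the rational centre, and from the centre to any other point of the
     square. *)
  have [n hn] : exists n : nat, 2 * n.+1%:R^-1 < e.
    have [n _ hn] := (near_infty_natSinv_lt (PosNum (divr_gt0 e0 (ltr0n _ 2)))).
    by exists n; rewrite mulrC -ltr_pdivlMr//; exact: (hn n (leqnn _)).
  have n0 : 0 < n.+1%:R^-1 :> R by rewrite invr_gt0.
  have qa (t : R) : exists q : rat, `|ratr q - t| < n.+1%:R^-1.
    have : t - n.+1%:R^-1 < t + n.+1%:R^-1 by rewrite ltrBlDr -addrA ltrDl addr_gt0.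
    move=> /rat_in_itvoo[q]; rewrite in_itv /= => /andP[h1 h2]; exists q.
    by rewrite ltr_distl h1 h2.
  have [q1 hq1] := qa x; have [q2 hq2] := qa y.
  exists q1 => //; exists q2 => //; exists n => //.
  rewrite /G; case: asboolP => [_|]; first by split; rewrite /= /ball /=.
  case => -[c d] [/= Hc Hd]; apply: he; move: Hc Hd; rewrite /ball /= => Hc Hd.
  split => /=; rewrite /ball /=.
    rewrite (le_lt_trans (ler_distD (ratr q1) _ _))// (lt_trans _ hn)// mulr2n mulrDl mul1r.
    by rewrite ltrD// distrC.
  rewrite (le_lt_trans (ler_distD (ratr q2) _ _))// (lt_trans _ hn)// mulr2n mulrDl mul1r.
  by rewrite ltrD// distrC.
apply: bigcupT_measurable_rat => q1; apply: bigcupT_measurable_rat => q2.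
apply: bigcupT_measurable => n; rewrite /G; case: ifP => // _.
by apply: measurableX; apply: open_measurable; apply: ball_open; rewrite invr_gt0.
Qed.

Lemma lebesgue_measure_translation (a : R) (A : set mR) :
  measurable A -> mu ((fun x => x + a) @^-1` A) = mu A.
Proof.
move=> mA.
have mt : measurable_fun setT (fun x : mR => x + a : mR).
  by apply: measurable_funD.
rewrite -[LHS]/(pushforward mu (fun x : mR => x + a : mR) A).
symmetry; apply: (@lebesgue_measure_unique _ (pushforward mu (fun x : mR => x + a : mR))) => //.
move=> X [[x y] _ <-] /=; rewrite /pushforward.
have -> : (fun x0 : mR => x0 + a) @^-1` `]x, y] = [set` `]x - a, y - a]%R].
  by apply/seteqP; split => t /=; rewrite !in_itv/= ltrBlDr lerBrDr.
rewrite !lebesgue_measure_itv /= !lte_fin ltrD2r; case: ifP => // _.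
by rewrite -!EFinB; congr (_%:E); ring.
Qed.

Local Notation mu2 := (mu \x mu)%E.

Definition shear1 (phi : R -> R) (p : mR * mR) : mR * mR := (p.1 + phi p.2, p.2).
Definition shear2 (phi : R -> R) (p : mR * mR) : mR * mR := (p.1, p.2 + phi p.1).

Definition area_preserving (S : mR * mR -> mR * mR) :=
  measurable_fun setT S /\ forall A, measurable A -> mu2 (S @^-1` A) = mu2 A.

(** For fixed x the section of the preimage is the section of A translated by [phi x], hence of the
    same length. *)
Lemma area_preserving_shear2 phi : measurable_fun setT (phi : mR -> mR) ->
  area_preserving (shear2 phi).
Proof.
move=> mphi; have mS : measurable_fun setT (shear2 phi).
  apply: measurable_fun_pair; first exact: measurable_fst.
  by apply: measurable_funD; [exact: measurable_snd|exact: (measurableT_comp mphi measurable_fst)].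
split=> // A mA; rewrite /product_measure1 /=.
apply: eq_integral => x _ /=.
rewrite -[RHS](lebesgue_measure_translation (phi x)); last exact: measurable_xsection.
congr (mu _); apply/seteqP; split => y; rewrite /xsection /= !inE //.
Qed.

(** Here the horizontal sections are translated, so the product measure is first rewritten as the
    integral of the lengths of horizontal sections, by uniqueness. *)
Lemma area_preserving_shear1 phi : measurable_fun setT (phi : mR -> mR) ->
  area_preserving (shear1 phi).
Proof.
move=> mphi; have mS : measurable_fun setT (shear1 phi).
  apply: measurable_fun_pair; last exact: measurable_snd.
  by apply: measurable_funD; [exact: measurable_fst|exact: (measurableT_comp mphi measurable_snd)].
split=> // A mA.
have E B : measurable B -> mu2 B = (mu \x^ mu)%E B.
  by apply: product_measure_unique => C D mC mD; exact: product_measure2E.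
rewrite !E//; last by rewrite -[_ @^-1` _]setTI; exact: mS.
apply: eq_integral => x _ /=.
rewrite -[RHS](lebesgue_measure_translation (phi x)); last exact: measurable_ysection.
congr (mu _); apply/seteqP; split => y; rewrite /ysection /= !inE //.
Qed.

Lemma area_preserving_comp S T : area_preserving S -> area_preserving T ->
  area_preserving (S \o T).
Proof.
move=> [mS pS] [mT pT]; split; first exact: measurableT_comp.
by move=> A mA; rewrite comp_preimage pT ?pS// -[_ @^-1` _]setTI; exact: mS.
Qed.

Lemma area_preserving_translation (a b : R) :
  area_preserving (fun p => (p.1 + a, p.2 + b)).
Proof.
have -> : (fun p : mR * mR => (p.1 + a, p.2 + b) : mR * mR)
  = shear1 (fun=> a) \o shear2 (fun=> b) by [].
by apply: area_preserving_comp; [apply: area_preserving_shear1|apply: area_preserving_shear2].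
Qed.

Definition rotation (c s : R) (p : mR * mR) : mR * mR :=
  (c * p.1 - s * p.2, s * p.1 + c * p.2).

(* A rotation by an angle t other than pi is a product of three shears, with
   coefficients -tan (t/2), sin t and -tan (t/2). *)
Lemma area_preserving_rotation (c s : R) : c ^+ 2 + s ^+ 2 = 1 ->
  area_preserving (rotation c s).
Proof.
have H (c' s' : R) : c' ^+ 2 + s' ^+ 2 = 1 -> 1 + c' != 0 -> area_preserving (rotation c' s').
  move=> cs c1; pose t := - (s' / (1 + c')).
  have -> : rotation c' s' =
      shear1 (fun y => t * y) \o (shear2 (fun x => s' * x) \o shear1 (fun y => t * y)).
    apply/funext => -[x y]; rewrite /rotation /shear1 /shear2 /=.
    have tt : t * (1 + c') = - s' by rewrite /t mulNr divfK.
    have ts : t * s' = c' - 1.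
      apply: (mulIf c1); rewrite mulrAC tt.
      have -> : (c' - 1) * (1 + c') = c' ^+ 2 - (c' ^+ 2 + s' ^+ 2) by rewrite cs; ring.
      ring.
    congr (_, _).
      have -> : x + t * y + t * (y + s' * (x + t * y)) =
        (1 + t * s') * x + t * (2 + t * s') * y by ring.
      rewrite ts; have -> : t * (2 + (c' - 1)) = t * (1 + c') by ring.
      by rewrite tt; ring.
    have -> : y + s' * (x + t * y) = s' * x + (1 + t * s') * y by ring.
    by rewrite ts; ring.
  have mt (r : R) : measurable_fun setT (fun x : mR => r * x : mR) by exact: measurable_funM.
  apply: area_preserving_comp; first exact: area_preserving_shear1.
  by apply: area_preserving_comp; [exact: area_preserving_shear2|exact: area_preserving_shear1].
(* The half turn, for which tan (t/2) is infinite, is the square of a quarter turn. *)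
move=> cs; have [c1|c1] := eqVneq (1 + c) 0; last exact: H.
have cN : c = -1 by apply/eqP; rewrite -addr_eq0 addrC c1.
have s0 : s = 0.
  by apply/eqP; rewrite -sqrf_eq0; apply/eqP; move: cs; rewrite cN; lra.
have -> : rotation c s = rotation 0 1 \o rotation 0 1.
  apply/funext => -[x y]; rewrite /rotation /= cN s0; congr (_, _); ring.
have R01 : area_preserving (rotation 0 1).
  by apply: H; [rewrite expr0n expr1n add0r|rewrite addr0 oner_neq0].
exact: area_preserving_comp.
Qed.

Lemma ge0_integral_area_preserving S (f : mR * mR -> \bar R) : area_preserving S ->
  measurable_fun setT f -> (forall p, 0 <= f p)%E ->
  (\int[mu2]_p f (S p) = \int[mu2]_p f p)%E.
Proof.
move=> [mS pS] mf f0.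
have := @ge0_integral_pushforward _ _ _ _ _ _ mS mu2 setT f measurableT mf (fun y _ => f0 y).
rewrite preimage_setT => <-.
by apply: eq_measure_integral => A mA _; exact: pS.
Qed.

Lemma integrable_area_preserving S (f : mR * mR -> R) : area_preserving S ->
  mu2.-integrable setT (EFin \o f) -> mu2.-integrable setT (EFin \o (f \o S)).
Proof.
move=> pS /integrableP[mf fi]; apply/integrableP; split.
  by have := measurableT_comp mf pS.1.
rewrite (@ge0_integral_area_preserving S (fun p => `|(f p)%:E|%E))//.
by apply: measurableT_comp.
Qed.

Lemma integral_area_preserving S (f : mR * mR -> R) : area_preserving S ->
  mu2.-integrable setT (EFin \o f) ->
  (\int[mu2]_p (f (S p))%:E = \int[mu2]_p (f p)%:E)%E.
Proof.
move=> pS fi.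
have mf : measurable_fun setT (EFin \o f) by case/integrableP: fi.
have fSi : mu2.-integrable (S @^-1` setT) ((EFin \o f) \o S).
  by rewrite preimage_setT; exact: integrable_area_preserving.
have H := integral_pushforward pS.1 mf fSi measurableT.
rewrite preimage_setT in H.
transitivity (\int[pushforward mu2 S]_p (f p)%:E)%E; first exact: (esym H).
by apply: eq_measure_integral => [|mS A mA _]; [exact: pS.1|exact: pS.2].
Qed.

End PlaneMeasure.

(** * Closed forms on rectangles *)

Section SegmentIntegral.
Variable R : realType.
Local Notation mu := (@lebesgue_measure R).
Implicit Types (f g : R -> R) (a b c M : R).

(** For b < a the segment is empty and the value is 0, with no sign convention; the lemmas on it
    therefore order their endpoints. *)
Definition segint f a b := \int[mu]_(x in `[a, b]) f x.

Lemma segint_integrable f a b : continuous f ->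
  mu.-integrable `[a, b] (EFin \o f).
Proof.
move=> cf; apply: continuous_compact_integrable; first exact: segment_compact.
exact: continuous_subspaceT.
Qed.

Lemma segint_cat f a b c : continuous f -> a <= b -> b <= c ->
  segint f a c = segint f a b + segint f b c.
Proof.
move=> cf ab bc; rewrite /segint.
have := @Rintegral_itvB R f (BLeft a) (BRight c) b (segint_integrable _ _ cf).
rewrite !bnd_simp => /(_ ab bc) h.
rewrite -[X in _ + X]Rintegral_itv_obnd_cbnd; first by rewrite -h; ring.
apply: (integrableS _ _ _ (segint_integrable b c cf)) => //.
by apply: subset_itvr; rewrite bnd_simp.
Qed.

Lemma segintB f g a b : continuous f -> continuous g ->
  segint (fun x => f x - g x) a b = segint f a b - segint g a b.
Proof. by move=> cf cg; rewrite /segint RintegralB//; exact: segint_integrable. Qed.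

Lemma segint_cst r a b : a <= b -> segint (fun=> r) a b = r * (b - a).
Proof.
move=> ab; rewrite /segint Rintegral_cst//= lebesgue_measure_itv/= lte_fin.
case: ltP => //; rewrite le_eqVlt (ltNge b) ab orbF => /eqP->.
by rewrite subrr.
Qed.

Lemma segint_bound f a b M : continuous f -> a <= b ->
  (forall x, a <= x <= b -> `|f x| <= M) -> `|segint f a b| <= M * (b - a).
Proof.
move=> cf ab fM; rewrite -segint_cst//.
apply: (le_trans (le_normr_Rintegral _ (segint_integrable a b cf))) => //.
apply: le_Rintegral => //.
- apply: segint_integrable => x.
  by apply: (@continuous_comp _ _ _ f Num.norm); [exact: cf|exact: norm_continuous].
- by apply: segint_integrable => x; exact: cst_continuous.
Qed.

End SegmentIntegral.

(** * Goursat's theorem for closed forms on rectangles *)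

Section Green.
Variable R : realType.
Variables P Q : R -> R -> R.

Definition lin_approx (F : R -> R -> R) (x0 y0 p q e d : R) :=
  forall x y, `|x - x0| < d -> `|y - y0| < d ->
  `|F x y - F x0 y0 - p * (x - x0) - q * (y - y0)| <= e * (`|x - x0| + `|y - y0|).

(* dQ/dx = dP/dy = r: the form P dx + Q dy is closed, but the partial
   derivatives need not be continuous *)
Hypothesis closed_form : forall x0 y0, exists p q r, forall e : R, 0 < e ->
  exists2 d : R, 0 < d & lin_approx P x0 y0 p r e d /\ lin_approx Q x0 y0 r q e d.

Lemma lin_approx_contx F p q x0 y0 : (forall e : R, 0 < e -> exists2 d : R, 0 < d &
    lin_approx F x0 y0 p q e d) -> {for x0, continuous (fun x => F x y0)}.
Proof.
move=> /(_ 1 ltr01)[d d0 Fd]; apply/cvgrPdist_lt => e e0.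
have K0 : 0 < 1 + `|p| by rewrite ltr_pwDl.
near=> x; rewrite distrC.
have xd : `|x - x0| < d by rewrite distrC; near: x; apply: (@nbhsx_ballx _ R^o).
have xe : `|x - x0| < e / (1 + `|p|) by rewrite distrC; near: x; apply: (@nbhsx_ballx _ R^o); rewrite divr_gt0.
have := Fd x y0 xd; rewrite subrr normr0 mulr0 subr0 addr0 mul1r => /(_ d0) h.
have -> : F x y0 - F x0 y0 = (F x y0 - F x0 y0 - p * (x - x0)) + p * (x - x0) by ring.
apply: (le_lt_trans (ler_normD _ _)); rewrite normrM.
apply: (@le_lt_trans _ _ ((1 + `|p|) * `|x - x0|)); first by rewrite mulrDl mul1r lerD2r.
by rewrite mulrC -ltr_pdivlMr.
Unshelve. all: by end_near. Qed.

Lemma lin_approx_conty F p q x0 y0 : (forall e : R, 0 < e -> exists2 d : R, 0 < d &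
    lin_approx F x0 y0 p q e d) -> {for y0, continuous (fun y => F x0 y)}.
Proof.
move=> /(_ 1 ltr01)[d d0 Fd]; apply/cvgrPdist_lt => e e0.
have K0 : 0 < 1 + `|q| by rewrite ltr_pwDl.
near=> x; rewrite distrC.
have xd : `|x - y0| < d by rewrite distrC; near: x; apply: (@nbhsx_ballx _ R^o).
have xe : `|x - y0| < e / (1 + `|q|) by rewrite distrC; near: x; apply: (@nbhsx_ballx _ R^o); rewrite divr_gt0.
have := Fd x0 x; rewrite subrr normr0 mulr0 subr0 add0r mul1r => /(_ d0 xd) h.
have -> : F x0 x - F x0 y0 = (F x0 x - F x0 y0 - q * (x - y0)) + q * (x - y0) by ring.
apply: (le_lt_trans (ler_normD _ _)); rewrite normrM.
apply: (@le_lt_trans _ _ ((1 + `|q|) * `|x - y0|)); first by rewrite mulrDl mul1r lerD2r.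
by rewrite mulrC -ltr_pdivlMr.
Unshelve. all: by end_near. Qed.

Lemma continuous_dx_coeff y : continuous (P^~ y).
Proof.
move=> x; have [p [q [r h]]] := closed_form x y.
by apply: (@lin_approx_contx P p r) => e /h[d d0 []]; exists d.
Qed.

Lemma continuous_dy_coeff x : continuous (Q x).
Proof.
move=> y; have [p [q [r h]]] := closed_form x y.
by apply: (@lin_approx_conty Q r q) => e /h[d d0 []]; exists d.
Qed.

(** The integral of P dx + Q dy around the boundary of [a, b] x [c, d], counterclockwise, with
    opposite sides paired. *)
Definition rect_circulation a b c d :=
  segint (fun x => P x c - P x d) a b + segint (fun y => Q b y - Q a y) c d.

(** The inner sides, on the lines through m and n, are run twice in opposite directions and
    cancel. *)
Lemma rect_circulation_split a m b c n d : a <= m -> m <= b -> c <= n -> n <= d ->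
  rect_circulation a b c d = rect_circulation a m c n + rect_circulation m b c n +
    rect_circulation a m n d + rect_circulation m b n d.
Proof.
move=> am mb cn nd; rewrite /rect_circulation.
have cP y : continuous (P^~ y) by exact: continuous_dx_coeff.
have cQ x : continuous (Q x) by exact: continuous_dy_coeff.
rewrite !segintB//.
rewrite !(segint_cat (cP _) am mb) !(segint_cat (cQ _) cn nd); ring.
Qed.

(** To first order, P changes by r (c - d') from top to bottom and Q by r (b - a) from left to
    right; integrated, these contributions are opposite, because the coefficient r is the same. Only
    the errors remain: two of size e times the half perimeter, over the lengths b - a and d' - c. *)
Lemma rect_circulation_local x0 y0 e : 0 < e -> exists2 d, 0 < d & forall a b c d',
  a <= x0 <= b -> c <= y0 <= d' -> b - a < d -> d' - c < d ->
  `|rect_circulation a b c d'| <= 2 * e * ((b - a) + (d' - c)) ^+ 2.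
Proof.
move=> e0; have [p [q [r /(_ e e0)[d d0 [hP hQ]]]]] := closed_form x0 y0.
exists d => // a b c d' /andP[ax xb] /andP[cy yd] ba dc.
have ab := le_trans ax xb; have cd := le_trans cy yd.
have cP y : continuous (P^~ y) by exact: continuous_dx_coeff.
have cQ x : continuous (Q x) by exact: continuous_dy_coeff.
have cPB : continuous (fun x => P x c - P x d').
  by move=> x; apply: (@cvgB _ R^o); exact: cP.
have cQB : continuous (fun y => Q b y - Q a y).
  by move=> y; apply: (@cvgB _ R^o); exact: cQ.
have cc (k : R) : continuous (fun _ : R => k) by move=> ?; exact: cst_continuous.
pose L := (b - a) + (d' - c).
have E : rect_circulation a b c d' = segint (fun x => (P x c - P x d') - r * (c - d')) a b +
    segint (fun y => (Q b y - Q a y) - r * (b - a)) c d'.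
  by rewrite segintB// [X in _ = _ + X]segintB// !segint_cst// /rect_circulation; ring.
have dx x : a <= x <= b -> `|x - x0| <= b - a.
  by move=> /andP[h1 h2]; rewrite ler_norml; apply/andP; split; lra.
have dy y : c <= y <= d' -> `|y - y0| <= d' - c.
  by move=> /andP[h1 h2]; rewrite ler_norml; apply/andP; split; lra.
have B F u v x y : lin_approx F x0 y0 u v e d -> a <= x <= b -> c <= y <= d' ->
    `|F x y - F x0 y0 - u * (x - x0) - v * (y - y0)| <= e * L.
  move=> hF /dx hx /dy hy; apply: (le_trans (hF x y _ _)).
  - exact: le_lt_trans hx ba.
  - exact: le_lt_trans hy dc.
  - by rewrite ler_pM2l// lerD.
rewrite E; have -> : 2 * e * L ^+ 2 = 2 * e * L * (b - a) + 2 * e * L * (d' - c).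
  by rewrite /L; ring.
apply: (le_trans (ler_normD _ _)); apply: lerD.
  apply: segint_bound => //.
    by move=> x; apply: (@cvgB _ R^o); [exact: cPB|exact: cc].
  move=> x xab.
  have h1 := B _ _ _ x c hP xab; have h2 := B _ _ _ x d' hP xab.
  have -> : P x c - P x d' - r * (c - d') = (P x c - P x0 y0 - p * (x - x0) - r * (c - y0))
     - (P x d' - P x0 y0 - p * (x - x0) - r * (d' - y0)) by ring.
  apply: (le_trans (ler_normB _ _)); rewrite -mulrA mulr2n mulrDl mul1r.
  by apply: lerD; [apply: h1; rewrite lexx|apply: h2; rewrite lexx andbT].
apply: segint_bound => //.
  by move=> x; apply: (@cvgB _ R^o); [exact: cQB|exact: cc].
move=> y ycd.
have h1 := B _ _ _ b y hQ; have h2 := B _ _ _ a y hQ.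
have -> : Q b y - Q a y - r * (b - a) = (Q b y - Q x0 y0 - r * (b - x0) - q * (y - y0))
   - (Q a y - Q x0 y0 - r * (a - x0) - q * (y - y0)) by ring.
apply: (le_trans (ler_normB _ _)); rewrite -mulrA mulr2n mulrDl mul1r.
by apply: lerD; [apply: h1 => //; rewrite lexx andbT|apply: h2 => //; rewrite lexx].
Qed.

(** Pigeonhole: the circulation is the sum of those of the four quarters, so one of them carries at
    least a quarter of it. *)
Lemma rect_circulation_bisect a b c d : a <= b -> c <= d -> exists a' c',
  [/\ a <= a', a' + (b - a) / 2 <= b, c <= c', c' + (d - c) / 2 <= d &
  `|rect_circulation a b c d| <=
    4 * `|rect_circulation a' (a' + (b - a) / 2) c' (c' + (d - c) / 2)| ].
Proof.
move=> ab cd; set u := (b - a) / 2; set v := (d - c) / 2.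
have u0 : 0 <= u by rewrite divr_ge0// subr_ge0.
have v0 : 0 <= v by rewrite divr_ge0// subr_ge0.
have bE : b = a + u + u by rewrite /u; field.
have dE : d = c + v + v by rewrite /v; field.
clearbody u v; subst b d.
have au : a <= a + u by rewrite lerDl.
have cv : c <= c + v by rewrite lerDl.
have aub : a + u <= a + u + u by rewrite lerDl.
have cvd : c + v <= c + v + v by rewrite lerDl.
have E := rect_circulation_split au aub cv cvd.
set A := rect_circulation _ _ _ _ in E *; set B1 := rect_circulation a (a + u) c _ in E.
set B2 := rect_circulation _ _ c _ in E; set B3 := rect_circulation a _ _ _ in E.
set B4 := rect_circulation _ _ _ _ in E.
have H : `|A| <= `|B1| + `|B2| + `|B3| + `|B4|.
  rewrite E; apply: (le_trans (ler_normD _ _)); rewrite lerD2r.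
  by apply: (le_trans (ler_normD _ _)); rewrite lerD2r ler_normD.
have [h1|h1] := leP `|A| (4 * `|B1|); first by exists a, c; split.
have [h2|h2] := leP `|A| (4 * `|B2|); first by exists (a + u), c; split.
have [h3|h3] := leP `|A| (4 * `|B3|); first by exists a, (c + v); split.
exists (a + u), (c + v); split => //.
by rewrite -/B4; lra.
Qed.

(** Bisection leaves a circulation of at least eta / 4^n at stage n, while the local estimate at the
    common point of the rectangles bounds it by 2 e D^2 / 4^n, with D the initial half perimeter: a
    contradiction once 2 e D^2 < eta. *)
Lemma rect_circulation_eq0 a b c d : a <= b -> c <= d -> rect_circulation a b c d = 0.
Proof.
move=> ab cd; apply/eqP; rewrite -normr_le0 leNgt; apply/negP.
move=> eta0; pose eta : R := `|rect_circulation a b c d|; rewrite -/eta in eta0.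
pose u n := (b - a) / 2 ^+ n; pose v n := (d - c) / 2 ^+ n.
have u0 n : 0 <= u n by rewrite divr_ge0 ?exprn_ge0// subr_ge0.
have v0 n : 0 <= v n by rewrite divr_ge0 ?exprn_ge0// subr_ge0.
have uS n : u n.+1 = u n / 2 by rewrite /u exprSr invfM mulrA.
have vS n : v n.+1 = v n / 2 by rewrite /v exprSr invfM mulrA.
(* All rectangles of stage n have sides [u n] and [v n], so only the lower left corner has to be
   chosen. *)
pose C n (p : R * R) := `|rect_circulation p.1 (p.1 + u n) p.2 (p.2 + v n)|.
have step (np : nat * (R * R)) : exists q : R * R,
    [/\ np.2.1 <= q.1, q.1 + u np.1.+1 <= np.2.1 + u np.1,
        np.2.2 <= q.2, q.2 + v np.1.+1 <= np.2.2 + v np.1 &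
        C np.1 np.2 <= 4 * C np.1.+1 q].
  case: np => n [x y] /=.
  have xu : x <= x + u n by rewrite lerDl.
  have yv : y <= y + v n by rewrite lerDl.
  have [x' [y' []]] := rect_circulation_bisect xu yv.
  rewrite !(addrC _ (u n)) !(addrC _ (v n)) !addrK -uS -vS => h1 h2 h3 h4 h5.
  exists (x', y'); rewrite /C /= !(addrC _ (u n)) !(addrC _ (v n)); split => //.
have [nxt hnxt] := choice step.
pose s := fix s n := if n is m.+1 then nxt (m, s m) else (a, c).
have sS n : s n.+1 = nxt (n, s n) by [].
have sC n : eta <= 4 ^+ n * C n (s n).
  elim: n => [|n IH].
    by rewrite mul1r /C /= /u /v expr0 !divr1 !(addrC _ (_ - _)) !subrK.
  apply: (le_trans IH); rewrite exprSr -mulrA ler_pM2l ?exprn_gt0//.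
  by rewrite sS; have [] := hnxt (n, s n).
have s1 n m : (s n).1 <= (s (n + m)%N).1 /\ (s (n + m)%N).1 + u (n + m)%N <= (s n).1 + u n.
  elim: m => [|m [IH1 IH2]]; first by rewrite addn0.
  rewrite addnS sS; have [h1 h2 _ _ _] := hnxt ((n + m)%N, s (n + m)%N).
  by split; [exact: le_trans h1|exact: le_trans h2 IH2].
have s2 n m : (s n).2 <= (s (n + m)%N).2 /\ (s (n + m)%N).2 + v (n + m)%N <= (s n).2 + v n.
  elim: m => [|m [IH1 IH2]]; first by rewrite addn0.
  rewrite addnS sS; have [_ _ h1 h2 _] := hnxt ((n + m)%N, s (n + m)%N).
  by split; [exact: le_trans h1|exact: le_trans h2 IH2].
(* Nested intervals: every right end bounds all the left ends, so the supremum of the left ends lies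
   in each interval. *)
have nest (z w : nat -> R) : (forall n, 0 <= w n) ->
    (forall n m, z n <= z (n + m)%N /\ z (n + m)%N + w (n + m)%N <= z n + w n) ->
    exists x, forall n, z n <= x <= z n + w n.
  move=> w0 H; have ub n : ubound (range z) (z n + w n).
    move=> _ [m _ <-]; have [nm|mn] := leP n m.
      have := (H n (m - n)%N).2; rewrite subnKC// => h.
      by rewrite (le_trans _ h)// lerDl.
    have := (H m (n - m)%N).1; rewrite subnKC ?(ltnW mn)// => h.
    by rewrite (le_trans h)// lerDl.
  exists (sup (range z)) => n; apply/andP; split.
    by apply: ub_le_sup; [exists (z 0%N + w 0%N); exact: ub|exists n].
  by apply: ge_sup; [exists (z 0%N); exists 0%N|exact: ub].
have [x0 hx0] := nest (fun n => (s n).1) u u0 s1.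
have [y0 hy0] := nest (fun n => (s n).2) v v0 s2.
pose D := (b - a) + (d - c).
have D0 : 0 <= D by rewrite addr_ge0// subr_ge0.
(* Chosen so that 2 e D^2 < eta; adding 1 keeps the denominator positive for a degenerate
   rectangle. *)
pose e := eta / (4 * (D ^+ 2 + 1)).
have e0 : 0 < e by rewrite divr_gt0// mulr_gt0// ltr_wpDl// sqr_ge0.
have [del del0 hdel] := rect_circulation_local x0 y0 e0.
have [n hn] : exists n : nat, D / 2 ^+ n < del.
  have /cvgrPdist_lt/(_ del del0)[n _ hn] : (D / 2 ^+ n : R^o) @[n --> \oo] --> (0 : R^o).
    rewrite -[X in _ --> X](mulr0 D); apply: cvgMr.
    under eq_fun do rewrite -exprVn.
    by apply: cvg_expr; rewrite ger0_norm ?invr_ge0// invf_lt1 ?ltr1n.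
  exists n; have := hn n (leqnn _); rewrite /= sub0r normrN ger0_norm//.
  by rewrite divr_ge0// exprn_ge0.
have DE : D / 2 ^+ n = u n + v n by rewrite /D mulrDl.
have := hdel (s n).1 ((s n).1 + u n) (s n).2 ((s n).2 + v n) (hx0 n) (hy0 n).
rewrite !(addrC _ (u n)) !(addrC _ (v n)) !addrK.
have un : u n < del by rewrite (le_lt_trans _ hn)// DE lerDl.
have vn : v n < del by rewrite (le_lt_trans _ hn)// DE lerDr.
move=> /(_ un vn) h.
have {h}h : C n (s n) <= 2 * e * (u n + v n) ^+ 2.
  by rewrite /C !(addrC _ (u n)) !(addrC _ (v n)) [v n + u n]addrC in h *.
have : eta <= 2 * e * D ^+ 2.
  apply: (le_trans (sC n)).
  apply: (@le_trans _ _ (4 ^+ n * (2 * e * (u n + v n) ^+ 2))).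
    by rewrite ler_pM2l// exprn_gt0.
  have h4 : (4 : R) ^+ n = (2 ^+ n) ^+ 2 by rewrite -exprM mulnC exprM;
    congr (_ ^+ n); rewrite expr2 -natrM.
  rewrite -DE h4 le_eqVlt; apply/orP; left; apply/eqP; field.
  by rewrite expf_neq0.
have : 2 * e * D ^+ 2 < eta.
  have He : e * (4 * (D ^+ 2 + 1)) = eta.
    by rewrite /e divfK// mulf_neq0// gt_eqF// ltr_wpDl// sqr_ge0.
  have -> : 2 * e * D ^+ 2 = e * (2 * D ^+ 2) by ring.
  by rewrite -He ltr_pM2l//; have := sqr_ge0 D; lra.
by move=> /lt_le_trans lt_trans /lt_trans; rewrite ltxx.
Qed.

(** Equal values of P on the lines y = 0 and y = T make the horizontal sides cancel, so the
    vanishing circulation compares the two vertical sides alone. *)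
Lemma segint_periodic a b T : 0 <= T -> (forall x, P x 0 = P x T) -> a <= b ->
  segint (Q a) 0 T = segint (Q b) 0 T.
Proof.
move=> T0 PT ab; have := rect_circulation_eq0 ab T0.
rewrite /rect_circulation segintB; [|exact: continuous_dx_coeff|exact: continuous_dx_coeff].
rewrite segintB; [|exact: continuous_dy_coeff|exact: continuous_dy_coeff].
have -> : P^~ 0 = P^~ T by apply/funext.
by rewrite subrr add0r => /eqP; rewrite subr_eq0 => /eqP.
Qed.

End Green.

(** * The mean value property *)

Section MeanValue.
Variable R : realType.
Implicit Types (f g : R[i] -> R[i]).

Lemma normc_real_imag (x y : R) : normc (x +i* y) <= `|x| + `|y|.
Proof. exact: normc_le_ReIm. Qed.

(** With P = Im f and Q = Re f the form P dx + Q dy is Im (f dz). The shared coefficient r = Re f'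
    is one of the Cauchy-Riemann equations, dP/dy = dQ/dx. *)
Lemma entire_closed_form f : entire f -> forall x0 y0 : R, exists p q r,
  forall e : R, 0 < e -> exists2 d : R, 0 < d &
    lin_approx (fun x y => complex.Im (f (x +i* y))) x0 y0 p r e d /\
    lin_approx (fun x y => complex.Re (f (x +i* y))) x0 y0 r q e d.
Proof.
move=> ef x0 y0; have [D fD] := derivable_cdiff (ef (x0 +i* y0)).
exists (complex.Im D), (- complex.Im D), (complex.Re D) => e e0.
have [d d0 hd] := fD e e0; exists (d / 2); first by rewrite divr_gt0.
suff H x y : `|x - x0| < d / 2 -> `|y - y0| < d / 2 ->
    normc (f (x +i* y) - f (x0 +i* y0) - D * ((x - x0) +i* (y - y0)))
      <= e * (`|x - x0| + `|y - y0|).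
  split=> x y hx hy; apply: le_trans (H x y hx hy).
    apply: le_trans (Im_le_normc _); case: (f _) (f _) (D) => a b [a' b'] [u v] /=.
    by rewrite le_eqVlt; apply/orP; left; apply/eqP; congr `|_|; ring.
  apply: le_trans (Re_le_normc _); case: (f _) (f _) (D) => a b [a' b'] [u v] /=.
  by rewrite le_eqVlt; apply/orP; left; apply/eqP; congr `|_|; ring.
move=> hx hy; have hh := normc_real_imag (x - x0) (y - y0).
have -> : x +i* y = (x0 +i* y0) + ((x - x0) +i* (y - y0)).
  by simpc; congr (_ +i* _); ring.
apply: (le_trans (hd _ _)); last by rewrite ler_pM2l.
by apply: (le_lt_trans hh); lra.
Qed.

Lemma mean_value_Re g (u : R[i]) : entire g ->
  segint (fun t => complex.Re (g (u * cexp (0 +i* t)))) 0 (pi *+ 2) =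
  complex.Re (g 0) * (pi *+ 2).
Proof.
move=> eg; set T : R := pi *+ 2.
have T0 : 0 <= T by rewrite /T mulrn_wge0// pi_ge0.
pose F z := g (u * cexp z).
have eF : entire F.
  exact: (@entire_comp R g (fun z => u * cexp z) eg (entireM (@entire_cst R u) (@entire_cexp R))).
have cF := entire_closed_form eF.
have per (x : R) : complex.Im (F (x +i* 0)) = complex.Im (F (x +i* T)).
  by rewrite /F /cexp /= /T cos2pi sin2pi cos0 sin0.
pose Q (x y : R) := complex.Re (F (x +i* y)).
pose P (x y : R) := complex.Im (F (x +i* y)).
apply/eqP; rewrite -subr_eq0 -normr_le0; apply/ler_addgt0Pl => e e0; rewrite addr0.
pose e' := e / (T + 1).
have T1 : 0 < T + 1 by rewrite ltr_wpDl.
have e'0 : 0 < e' by rewrite divr_gt0.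
have [d d0 hd] := entire_cont 0 eg e'0.
(* A circle of radius |u| e^(-K) < d is wanted, where g is within e' of g 0; this K works since e^K
   >= 1 + K > K. *)
pose K := normc u / d.
have K0 : 0 <= K by rewrite divr_ge0 ?normc_ge0// ltW.
have K1 : - K <= 0 by rewrite oppr_le0.
have H : segint (Q (- K)) 0 T = segint (Q 0) 0 T.
  exact: (@segint_periodic R P Q cF (- K) 0 T T0 per K1).
rewrite -[segint _ 0 T]/(segint (Q 0) 0 T) -H.
have -> : complex.Re (g 0) * T = segint (fun=> complex.Re (g 0)) 0 T.
  by rewrite segint_cst ?subr0.
have cQ : continuous (fun y => complex.Re (F (- K +i* y))).
  exact: (@continuous_dy_coeff R P Q cF (- K)).
clear eF cF eg H per; clearbody T.
have cc : continuous (fun _ : R => complex.Re (g 0)) by move=> ?; exact: cst_continuous.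
rewrite -segintB//.
apply: (@le_trans _ _ (e' * (T - 0))).
  apply: segint_bound => //.
    by move=> y; apply: (@cvgB _ R^o); [exact: cQ|exact: cc].
  move=> y _; rewrite /F.
  have := hd (u * cexp (- K +i* y)); rewrite subr0 Normc.normcM normc_cexp /=.
  have /[swap]/[apply] : normc u * expR (- K) < d.
    rewrite expRN -ltr_pdivlMr ?invr_gt0 ?expR_gt0// invrK mulrC -ltr_pdivrMr//.
    by have := expR_ge1Dx K; rewrite -/K; lra.
  move=> /ltW; apply: le_trans; apply: le_trans (Re_le_normc _).
  by rewrite ReB.
rewrite subr0 /e' mulrAC ler_pdivrMr// ler_pM2l//; lra.
Qed.

End MeanValue.

(** * Gaussian means of entire functions *)

(* The library declares sigma-finiteness of a product of sigma-finite measures,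
   but this instance is shadowed by that of products of subprobabilities. *)
Section PlaneSigmaFinite.
Variable R : realType.
Local Notation mu := (@lebesgue_measure R).

Definition plane_measure := (mu \x mu)%E.

HB.instance Definition _ := Measure.on plane_measure.

Lemma plane_measure_sigma_finite : sigma_finite setT plane_measure.
Proof.
have /sigma_finiteP[F [TF ndF Foo]] := sigma_finiteT mu.
exists (fun n => F n `*` F n).
  rewrite -setXTT TF predeqE => -[x y]; split.
    move=> [/= [n _ Fnx] [k _ Gky]]; exists (maxn n k) => //; split.
    - by move: x Fnx; exact/subsetPset/ndF/leq_maxl.
    - by move: y Gky; exact/subsetPset/ndF/leq_maxr.
  by move=> [n _ []/= ? ?]; split; exists n.
move=> k; have [mF Fk] := Foo k; split; first exact: measurableX.
by rewrite /plane_measure product_measure1E// lte_mul_pinfty// ge0_fin_numE.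
Qed.

HB.instance Definition _ := Measure_isSigmaFinite.Build _ _ _ plane_measure
  plane_measure_sigma_finite.

End PlaneSigmaFinite.

Section GaussianMean.
Variable R : realType.
Local Notation mu := (@lebesgue_measure R).
Local Notation mR := (measurableTypeR R).
Local Notation mu2 := (mu \x mu)%E.
Implicit Types (f g : R[i] -> R[i]).

Definition planec (p : mR * mR) : R[i] := p.1 +i* p.2.

Lemma gauss_weightE (z : R[i]) :
  gauss_weight z = expR (- (complex.Re z ^+ 2 + complex.Im z ^+ 2)).
Proof. by rewrite /gauss_weight normc_sqr. Qed.

Lemma continuous_entire_Re f : entire f ->
  continuous (fun p : R * R => complex.Re (f (p.1 +i* p.2))).
Proof.
move=> ef [x y]; apply/cvgrPdist_lt => e e0.
have [d d0 hd] := entire_cont (x +i* y) ef e0; clear ef.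
have : nbhs ((x, y) : R * R) (ball ((x, y) : R * R) (d / 2)).
  by apply: nbhsx_ballx; rewrite divr_gt0.
apply: filterS => -[x' y'] [/= hx hy]; rewrite distrC -ReB.
apply: (le_lt_trans (Re_le_normc _)); apply: hd.
apply: (le_lt_trans (normc_le_ReIm _)) => /=.
move: hx hy; rewrite /ball /= => hx hy.
by rewrite [d]splitr ltrD// distrC.
Qed.

(** Multiplication by -i turns imaginary parts into real parts, so statements on real parts of
    entire functions yield those on imaginary parts. *)
Lemma entireN_imul f : entire f -> entire (fun z => (0 +i* (-1)) * f z).
Proof. by move=> ef; exact: (entireM (@entire_cst R (0 +i* (-1))) ef). Qed.

Lemma Re_Nimul (z : R[i]) : complex.Re ((0 +i* (-1)) * z) = complex.Im z.
Proof. by case: z => a b /=; ring. Qed.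

Lemma measurable_entire_Re f : entire f ->
  measurable_fun setT (fun p : mR * mR => complex.Re (f (planec p)) : mR).
Proof.
by move=> ef; apply: measurable_fun_continuous2; exact: continuous_entire_Re.
Qed.

Lemma measurable_entire_Im f : entire f ->
  measurable_fun setT (fun p : mR * mR => complex.Im (f (planec p)) : mR).
Proof.
move=> /entireN_imul/measurable_entire_Re.
by under eq_fun do rewrite Re_Nimul.
Qed.

Lemma measurable_weight :
  measurable_fun setT (fun p : mR * mR => gauss_weight (planec p) : mR).
Proof.
rewrite [X in measurable_fun _ X](_ : _ = fun p => expR (- (p.1 ^+ 2 + p.2 ^+ 2))); last first.
  by apply/funext => p; rewrite gauss_weightE.
apply: measurableT_comp => //; apply: measurableT_comp => //.
by apply: measurable_funD; apply: measurable_funX.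
Qed.

(** The weight is a product of two one-dimensional Gaussians, each of integral sqrt pi. *)
Lemma integral_weight : (\int[mu2]_p (gauss_weight (planec p))%:E = pi%:E)%E.
Proof.
rewrite fubini_tonelli1; last 2 first.
- by apply/measurable_EFinP; exact: measurable_weight.
- by move=> p; rewrite lee_fin expR_ge0.
rewrite /fubini_F.
transitivity (\int[mu]_x ((Num.sqrt pi)%:E * (gauss_fun x)%:E))%E.
  apply: eq_integral => x _.
  transitivity (\int[mu]_y ((gauss_fun x)%:E * (gauss_fun y)%:E))%E.
    apply: eq_integral => y _; rewrite gauss_weightE -EFinM /gauss_fun -expRD /=.
    by congr (expR _)%:E; rewrite opprD.
  rewrite ge0_integralZl//.
  - by rewrite integralT_gauss muleC.
  - by apply/measurable_EFinP; exact: measurable_gauss_fun.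
  - by move=> y _; rewrite lee_fin gauss_fun_ge0.
  - by rewrite lee_fin gauss_fun_ge0.
rewrite ge0_integralZl//.
- by rewrite integralT_gauss -EFinM -expr2 sqr_sqrtr// pi_ge0.
- by apply/measurable_EFinP; exact: measurable_gauss_fun.
- by move=> y _; rewrite lee_fin gauss_fun_ge0.
Qed.

Lemma integrable_weight :
  mu2.-integrable setT (EFin \o (fun p => gauss_weight (planec p))).
Proof.
apply/integrableP; split; first by apply/measurable_EFinP; exact: measurable_weight.
under eq_integral do rewrite /= ger0_norm ?expR_ge0//.
by rewrite integral_weight ltry.
Qed.

Lemma rotation_planec (t : R) (p : mR * mR) :
  planec (rotation (cos t) (sin t) p) = planec p * cexp (0 +i* t).
Proof.
case: p => x y; rewrite /planec /rotation /cexp /= expR0 !mul1r.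
by simpc; congr (_ +i* _); ring.
Qed.

Lemma weight_rotation (t : R) (p : mR * mR) :
  gauss_weight (planec (rotation (cos t) (sin t) p)) = gauss_weight (planec p).
Proof.
by rewrite rotation_planec /gauss_weight Normc.normcM normc_cexp /= expR0 mulr1.
Qed.

(** The rotated integrand is integrated over angle and plane in both orders. Angle first, the weight
    factors out and the mean value property leaves T Re (g 0) times the weight; plane first, every
    angle gives the integral of h. Comparing and cancelling T = 2 pi gives the value. *)
Lemma gaussian_mean_Re g : entire g ->
  mu2.-integrable setT
    (EFin \o (fun p => complex.Re (g (planec p)) * gauss_weight (planec p))) ->
  (\int[mu2]_p (complex.Re (g (planec p)) * gauss_weight (planec p))%:E =
   (pi * complex.Re (g 0))%:E)%E.
Proof.
move=> eg; set h := fun p => _ => ih.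
have mgRe := measurable_entire_Re eg.
have MV u := mean_value_Re u eg.
have cg u : continuous (fun t : R => complex.Re (g (u * cexp (0 +i* t)))).
  have eF := @entire_comp R g (fun z => u * cexp z) eg (entireM (@entire_cst R u) (@entire_cexp R)).
  have := @continuous_dy_coeff R _ _ (entire_closed_form eF) 0; exact.
clear eg.
have mh : measurable_fun setT (h : mR * mR -> mR).
  by apply: measurable_funM => //; exact: measurable_weight.
have T0 : 0 < pi *+ 2 :> R by rewrite mulrn_wgt0// pi_gt0.
move: MV T0; set T : R := pi *+ 2; clearbody T => MV T0.
pose D : set mR := [set` `[0, T]%R].
(* The indicator restricts the angle to [0, T] while both integrals range over whole spaces, as in
   Fubini's theorem. *)
pose F (q : (mR * mR) * mR) : R :=
  \1_D q.2 * h (rotation (cos q.2) (sin q.2) q.1).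
have mD : measurable D by exact: measurable_itv.
have mcos : measurable_fun setT (fun q : (mR * mR) * mR => cos q.2 : mR).
  by apply: (measurableT_comp (continuous_measurable_fun (@continuous_cos R))).
have msin : measurable_fun setT (fun q : (mR * mR) * mR => sin q.2 : mR).
  by apply: (measurableT_comp (continuous_measurable_fun (@continuous_sin R))).
have m11 : measurable_fun setT (fun q : (mR * mR) * mR => q.1.1 : mR).
  exact: (measurableT_comp measurable_fst measurable_fst).
have m12 : measurable_fun setT (fun q : (mR * mR) * mR => q.1.2 : mR).
  exact: (measurableT_comp measurable_snd measurable_fst).
have m1D : measurable_fun setT (\1_D : mR -> mR) by exact: measurable_indic.
have mF : measurable_fun setT (F : _ -> mR).
  apply: measurable_funM.
    exact: (measurableT_comp m1D measurable_snd).
  apply: (measurableT_comp mh); apply: measurable_fun_pair.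
    by apply: measurable_funB; apply: measurable_funM.
  by apply: measurable_funD; apply: measurable_funM.
have Rt (t : R) : area_preserving (rotation (cos t) (sin t)).
  by apply: area_preserving_rotation; exact: cos2Dsin2.
have mabsh : measurable_fun setT (fun p => `|(h p)%:E|%E).
  by apply: measurableT_comp => //; apply/measurable_EFinP.
have mD1 : measurable_fun setT (fun t : mR => (\1_D t)%:E : \bar R).
  by apply/measurable_EFinP.
have iD : (\int[mu]_t (\1_D t)%:E = T%:E)%E.
  rewrite integral_indic// setIT.
  have := lebesgue_measure_itv `[0, T]%R; rewrite /= lte_fin T0 oppr0 adde0; exact.
have mEF : measurable_fun setT (EFin \o F) by exact/measurable_EFinP.
(* Rotation invariance applied to |h|: the iterated integral is T times the integral of |h|, which
   is finite. *)
have iF : (\int[mu]_t \int[mu2]_p `|(EFin \o F) (p, t)| < +oo)%E.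
  have -> : (\int[mu]_t \int[mu2]_p `|(EFin \o F) (p, t)| =
    \int[mu]_t ((\int[mu2]_p `|(h p)%:E|) * (\1_D t)%:E))%E.
    apply: eq_integral => t _; rewrite muleC -(ge0_integral_area_preserving (Rt t) mabsh (fun=> abse_ge0 _)).
    rewrite -ge0_integralZl//.
    - by apply: eq_integral => p _; rewrite /F /= normrM EFinM (ger0_norm (_ : 0 <= \1_D t)) ?indicE.
    - exact: (measurableT_comp mabsh (Rt t).1).
  have [_ ih'] := (integrableP _ _ _ ih).
  rewrite ge0_integralZl//.
  - by rewrite iD lte_mul_pinfty// ?ltry// ?ge0_fin_numE// integral_ge0.
  - by apply: integral_ge0.
have FE : (\int[mu2]_p \int[mu]_t (EFin \o F) (p, t) =
    \int[mu]_t \int[mu2]_p (EFin \o F) (p, t))%E.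
  have [_ iFF] := @integrable21ltyP _ _ _ _ _ (@plane_measure R) mu (EFin \o F) mEF.
  exact: (Fubini (iFF iF)).
move: FE.
have -> : (\int[mu2]_p \int[mu]_t (EFin \o F) (p, t) =
   \int[mu2]_p ((complex.Re (g 0) * T)%:E * (gauss_weight (planec p))%:E))%E.
  apply: eq_integral => p _.
  transitivity (\int[mu]_(t in D) (complex.Re (g (planec p * cexp (0 +i* t))) * gauss_weight (planec p))%:E)%E.
    rewrite [RHS]integral_mkcond; apply: eq_integral => t _.
    rewrite patchE /F /= indicE /h weight_rotation rotation_planec.
    by case: ifP => _; rewrite ?mul1r ?mul0r.
  have iseg := segint_integrable 0 T (cg (planec p)).
  have -> : (\int[mu]_(t in D) (complex.Re (g (planec p * cexp (0 +i* t))) * gauss_weight (planec p))%:E =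
     (\int[mu]_(t in D) ((gauss_weight (planec p))%:E * (complex.Re (g (planec p * cexp (0 +i* t))))%:E)))%E.
    by apply: eq_integral => t _; rewrite -EFinM mulrC.
  rewrite integralZl// -[X in (_ * X)%E]fineK; last exact: integrable_fin_num.
  by rewrite -[fine _]/(segint (fun t => complex.Re (g (planec p * cexp (0 +i* t)))) 0 T) MV muleC.
have -> : (\int[mu]_t \int[mu2]_p (EFin \o F) (p, t) =
   \int[mu]_t ((\int[mu2]_p (h p)%:E) * (\1_D t)%:E))%E.
  apply: eq_integral => t _; rewrite muleC -(integral_area_preserving (Rt t) ih).
  rewrite -integralZl//; last exact: (integrable_area_preserving (Rt t) ih).
have iw := integrable_weight.
rewrite integralZl// integral_weight.
have hI : (\int[mu2]_p (h p)%:E)%E = (fine (\int[mu2]_p (h p)%:E)%E)%:E.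
  by rewrite fineK//; exact: (integrable_fin_num measurableT ih).
rewrite hI; move: (fine _) hI => I hI.
rewrite integralZl//; last first.
  apply/integrableP; split => //.
  rewrite (_ : (\int[mu]_t _)%E = T%:E) ?ltry// -iD.
  by apply: eq_integral => t _; rewrite gee0_abs// lee_fin.
rewrite iD -EFinM -EFinM => -[E].

congr (_%:E); apply: (mulIf (lt0r_neq0 T0)); rewrite -E; ring.
Qed.

End GaussianMean.

(** * Semi-inner products *)

Section SemiInnerProduct.
Variables (R : realType) (E : Type).
Variables (H : set (E -> R[i])) (ip : (E -> R[i]) -> (E -> R[i]) -> R[i]).

(** Definiteness is left out: for measurable functions, [ip f f = 0] only forces f to vanish almost
    everywhere. *)
Record is_semi_inner_product : Prop := {
  sip_Dl : forall f g h, H f -> H g -> H h ->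
    ip (fun x => f x + g x) h = ip f h + ip g h;
  sip_Zl : forall (a : R[i]) f h, H f -> H h ->
    ip (fun x => a * f x) h = a * ip f h;
  sip_herm : forall f g, H f -> H g -> ip g f = conjc (ip f g);
  sip_ge0 : forall f, H f -> 0 <= ip f f
}.

Hypotheses (subH : is_subspace H) (sipH : is_semi_inner_product).

Local Notation N := (ip_norm ip).

Lemma sip_Dr f g h : H f -> H g -> H h ->
  ip h (fun x => f x + g x) = ip h f + ip h g.
Proof.
move=> Hf Hg Hh; rewrite (sip_herm sipH (subspaceD subH Hf Hg) Hh).
rewrite (sip_Dl sipH Hf Hg Hh) rmorphD /=.
by rewrite -(sip_herm sipH Hf Hh) -(sip_herm sipH Hg Hh).
Qed.

Lemma sip_Zr a f h : H f -> H h -> ip h (fun x => a * f x) = conjc a * ip h f.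
Proof.
move=> Hf Hh; rewrite (sip_herm sipH (subspaceZ subH a Hf) Hh).
by rewrite (sip_Zl sipH a Hf Hh) rmorphM /= -(sip_herm sipH Hf Hh).
Qed.

Lemma subspaceB f g : H f -> H g -> H (fun x => f x - g x).
Proof.
move=> Hf Hg; have -> : (fun x => f x - g x) = (fun x => f x + (-1) * g x).
  by apply/funext => x; rewrite mulN1r.
exact: (subspaceD subH Hf (subspaceZ subH _ Hg)).
Qed.

Lemma sip_Bl f g h : H f -> H g -> H h ->
  ip (fun x => f x - g x) h = ip f h - ip g h.
Proof.
move=> Hf Hg Hh; have -> : (fun x => f x - g x) = (fun x => f x + (-1) * g x).
  by apply/funext => x; rewrite mulN1r.
by rewrite (sip_Dl sipH Hf (subspaceZ subH _ Hg) Hh) (sip_Zl sipH _ Hg Hh) mulN1r.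
Qed.

Lemma sip_Br f g h : H f -> H g -> H h ->
  ip h (fun x => f x - g x) = ip h f - ip h g.
Proof.
move=> Hf Hg Hh; have -> : (fun x => f x - g x) = (fun x => f x + (-1) * g x).
  by apply/funext => x; rewrite mulN1r.
rewrite (sip_Dr Hf (subspaceZ subH _ Hg) Hh) (sip_Zr _ Hg Hh).
by rewrite rmorphN rmorph1 mulN1r.
Qed.

Lemma Re_sip_ge0 f : H f -> 0 <= complex.Re (ip f f).
Proof. by move=> /(sip_ge0 sipH); case: (ip f f) => a b /=; rewrite lecE /= => /andP[]. Qed.

Lemma ip_norm_ge0 f : 0 <= N f.
Proof. exact: sqrtr_ge0. Qed.

Lemma sqr_ip_norm f : H f -> N f ^+ 2 = complex.Re (ip f f).
Proof. by move=> Hf; rewrite sqr_sqrtr// Re_sip_ge0. Qed.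

Lemma ip_normZ a f : H f -> N (fun x => a * f x) = normc a * N f.
Proof.
move=> Hf; rewrite /ip_norm (sip_Zl sipH _ Hf (subspaceZ subH _ Hf)) (sip_Zr _ Hf Hf).
rewrite mulrA mulc_conj ReM /= mul0r subr0 sqrtrM ?sqr_ge0// sqrtr_sqr ger0_norm//.
exact: normc_ge0.
Qed.

(** This is the expansion of 0 <= |f + a g|^2 with a of modulus 1. *)
Lemma sip_polar a f g : H f -> H g -> normc a = 1 ->
  - (2 * complex.Re (conjc a * ip f g)) <= N f ^+ 2 + N g ^+ 2.
Proof.
move=> Hf Hg a1; have Hag := subspaceZ subH a Hg.
have := Re_sip_ge0 (subspaceD subH Hf Hag).
rewrite (sip_Dl sipH Hf Hag (subspaceD subH Hf Hag)) !(sip_Dr Hf Hag)//.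
rewrite !ReD -!sqr_ip_norm// ip_normZ// a1 mul1r (sip_Zl sipH _ Hg Hf) (sip_Zr _ Hg Hf).
rewrite (sip_herm sipH Hf Hg).
have -> : complex.Re (a * conjc (ip f g)) = complex.Re (conjc a * ip f g).
  by case: (a) (ip f g) => u v [x y] /=; ring.
lra.
Qed.

(** The units 1, -1, i, -i in [sip_polar] bound the real and imaginary parts of the pairing, each by
    half the right-hand side. *)
Lemma sip_le_sum f g : H f -> H g -> normc (ip f g) <= N f ^+ 2 + N g ^+ 2.
Proof.
move=> Hf Hg; apply: (le_trans (normc_le_ReIm _)).
have P a : normc a = 1 -> - (2 * complex.Re (conjc a * ip f g)) <= N f ^+ 2 + N g ^+ 2.
  exact: sip_polar.
have n1 : normc (1 : R[i]) = 1 by rewrite Normc.normc1.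
have nN1 : normc (-1 : R[i]) = 1 by rewrite normcN n1.
have ni : normc (0 +i* 1 : R[i]) = 1 by rewrite /= expr0n expr1n add0r sqrtr1.
have nNi : normc (0 +i* (-1) : R[i]) = 1 by rewrite /= expr0n sqrrN expr1n add0r sqrtr1.
move: (P _ n1) (P _ nN1) (P _ ni) (P _ nNi); case: (ip f g) => x y /=.
move=> h1 h2 h3 h4.
have hx : `|x| <= (N f ^+ 2 + N g ^+ 2) / 2.
  by rewrite ler_norml; apply/andP; split; lra.
have hy : `|y| <= (N f ^+ 2 + N g ^+ 2) / 2.
  by rewrite ler_norml; apply/andP; split; lra.
by rewrite [leRHS]splitr lerD.
Qed.

(* Applied to f/(|f| + e) and g/(|g| + e), [sip_le_sum] gives a form of the
   Cauchy-Schwarz inequality. *)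
Lemma sip_cauchy_schwarz f g : H f -> H g -> normc (ip f g) <= 2 * (N f * N g).
Proof.
move=> Hf Hg; set A := N f; set B := N g.
have A0 : 0 <= A := ip_norm_ge0 f; have B0 : 0 <= B := ip_norm_ge0 g.
have K e : 0 < e -> normc (ip f g) <= 2 * ((A + e) * (B + e)).
  move=> e0; have Ae : 0 < A + e by rewrite ltr_wpDl.
  have Be : 0 < B + e by rewrite ltr_wpDl.
  have := sip_le_sum (subspaceZ subH ((A + e)^-1)%:C Hf) (subspaceZ subH ((B + e)^-1)%:C Hg).
  rewrite (sip_Zl sipH _ Hf (subspaceZ subH _ Hg)) (sip_Zr _ Hg Hf).
  rewrite !Normc.normcM normc_conj !ip_normZ// !normcR -/A -/B.
  have iA : 0 <= (A + e)^-1 by rewrite invr_ge0 ltW.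
  have iB : 0 <= (B + e)^-1 by rewrite invr_ge0 ltW.
  rewrite (ger0_norm iA) (ger0_norm iB) => h.
  have -> : normc (ip f g) = (A + e) * (B + e) * ((A + e)^-1 * ((B + e)^-1 * normc (ip f g))).
    by field; rewrite !gt_eqF.
  rewrite [leRHS]mulrC ler_pM2l ?mulr_gt0//; apply: (le_trans h).
  have le1 x : 0 <= x -> ((x + e)^-1 * x) ^+ 2 <= 1.
    move=> x0; have xe : 0 < x + e by rewrite ltr_wpDl.
    rewrite expr_le1//; last by rewrite mulr_ge0// invr_ge0 ltW.
    by rewrite mulrC ler_pdivrMr// mul1r lerDl ltW.
  by rewrite (_ : 2 = 1 + 1)// lerD// le1.
rewrite leNgt; apply/negP => c.
pose d := normc (ip f g) - 2 * (A * B).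
have d0 : 0 < d by rewrite subr_gt0.
pose S := A + B + 1.
have S0 : 0 < S by rewrite /S; lra.
(* As e <= 1, (A + e) (B + e) exceeds A B by at most e S, and 2 e S <= d / 2 is less than the
   supposed gap d. *)
pose e := Num.min 1 (d / (4 * S)).
have e0 : 0 < e by rewrite lt_min ltr01 divr_gt0// mulr_gt0.
have e1 : e <= 1 by rewrite ge_min lexx.
have e2 : e * (4 * S) <= d by rewrite -ler_pdivlMr ?mulr_gt0// ge_min lexx orbT.
have ee : e * e <= e by rewrite ler_piMr// ltW.
have := K e e0; rewrite leNgt => /negP; apply.
have -> : normc (ip f g) = d + 2 * (A * B) by rewrite /d subrK.
have -> : (A + e) * (B + e) = A * B + (e * (A + B) + e * e) by ring.
by move: e2; rewrite /S; lra.
Qed.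

End SemiInnerProduct.

(** * Square integrability for the Gaussian weight *)

Section GaussianL2.
Variable R : realType.
Local Notation mu := (@lebesgue_measure R).
Local Notation mR := (measurableTypeR R).
Local Notation mu2 := (mu \x mu)%E.
Implicit Types (f g : R[i] -> R[i]).

Definition cmeas f :=
  measurable_fun setT (fun p : mR * mR => complex.Re (f (planec p)) : mR) /\
  measurable_fun setT (fun p : mR * mR => complex.Im (f (planec p)) : mR).

Lemma cmeasD f g : cmeas f -> cmeas g -> cmeas (fun z => f z + g z).
Proof.
move=> [rf jf] [rg jg]; split.
  by under eq_fun do rewrite ReD; exact: measurable_funD.
by under eq_fun do rewrite ImD; exact: measurable_funD.
Qed.

Lemma cmeasM f g : cmeas f -> cmeas g -> cmeas (fun z => f z * g z).
Proof.
move=> [rf jf] [rg jg]; split.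
  by under eq_fun do rewrite ReM; apply: measurable_funB; exact: measurable_funM.
by under eq_fun do rewrite ImM; apply: measurable_funD; exact: measurable_funM.
Qed.

Lemma cmeas_cst (a : R[i]) : cmeas (fun=> a).
Proof. by split; exact: measurable_cst. Qed.

Lemma Re_conjc (z : R[i]) : complex.Re (conjc z) = complex.Re z.
Proof. by case: z. Qed.
Lemma Im_conjc (z : R[i]) : complex.Im (conjc z) = - complex.Im z.
Proof. by case: z. Qed.

Lemma conjcM (z w : R[i]) : conjc (z * w) = conjc z * conjc w.
Proof. exact: rmorphM. Qed.
Lemma conjcR (a : R) : conjc a%:C = a%:C.
Proof. by rewrite /= oppr0. Qed.

Lemma cmeas_conj f : cmeas f -> cmeas (fun z => conjc (f z)).
Proof.
move=> [rf jf]; split; first by under eq_fun do rewrite Re_conjc.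
by under eq_fun do rewrite Im_conjc; exact: measurableT_comp.
Qed.

Lemma cmeas_weight : cmeas (fun z : R[i] => (gauss_weight z)%:C).
Proof. by split; [exact: measurable_weight|exact: measurable_cst]. Qed.

Lemma cmeas_entire f : entire f -> cmeas f.
Proof. by move=> ef; split; [exact: measurable_entire_Re|exact: measurable_entire_Im]. Qed.

Lemma cmeas_normc2 f : cmeas f ->
  measurable_fun setT (fun p : mR * mR => normc (f (planec p)) ^+ 2 : mR).
Proof.
move=> [rf jf]; under eq_fun do rewrite normc_sqr.
by apply: measurable_funD; exact: measurable_funX.
Qed.

Definition cintegrable f :=
  mu2.-integrable setT (EFin \o (fun p => complex.Re (f (planec p)))) /\
  mu2.-integrable setT (EFin \o (fun p => complex.Im (f (planec p)))).

Lemma plane_integralE f : plane_integral f =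
  (\int[mu2]_p complex.Re (f (planec p))) +i* (\int[mu2]_p complex.Im (f (planec p))).
Proof. by []. Qed.

Lemma plane_integralD f g : cintegrable f -> cintegrable g ->
  plane_integral (fun z => f z + g z) = plane_integral f + plane_integral g.
Proof.
move=> [rf jf] [rg jg]; rewrite !plane_integralE; simpc; congr (_ +i* _).
  by rewrite -RintegralD//; apply: eq_Rintegral => p _; rewrite ReD.
by rewrite -RintegralD//; apply: eq_Rintegral => p _; rewrite ImD.
Qed.

Lemma integrable_scale (a : R) (F : mR * mR -> R) :
  mu2.-integrable setT (EFin \o F) ->
  mu2.-integrable setT (EFin \o (fun p => a * F p)).
Proof.
move=> iF.
have -> : EFin \o (fun p => a * F p) = (fun p => a%:E * (EFin \o F) p)%E.
  by apply/funext => p /=; rewrite EFinM.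
exact: integrableZl.
Qed.

Lemma integrable_add (F G : mR * mR -> R) :
  mu2.-integrable setT (EFin \o F) -> mu2.-integrable setT (EFin \o G) ->
  mu2.-integrable setT (EFin \o (fun p => F p + G p)).
Proof. by move=> iF iG; exact: (integrableD measurableT iF iG). Qed.

Lemma plane_integralZ (a : R[i]) f : cintegrable f ->
  plane_integral (fun z => a * f z) = a * plane_integral f.
Proof.
move=> [rf jf]; rewrite !plane_integralE.
have L (c d : R) : \int[mu2]_p (c * complex.Re (f (planec p)) + d * complex.Im (f (planec p)))
    = c * (\int[mu2]_p complex.Re (f (planec p))) + d * (\int[mu2]_p complex.Im (f (planec p))).
  rewrite RintegralD//; [|exact: integrable_scale|exact: integrable_scale].
  by rewrite !RintegralZl.
case: a => c d; simpc; congr (_ +i* _).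
  rewrite -mulNr -L; apply: eq_Rintegral => p _; rewrite ReM /=; ring.
rewrite addrC -L; apply: eq_Rintegral => p _; rewrite ImM /=; ring.
Qed.

Lemma plane_integral_conj f : cintegrable f ->
  plane_integral (fun z => conjc (f z)) = conjc (plane_integral f).
Proof.
move=> [rf jf]; rewrite !plane_integralE /=; congr (_ +i* _).
  by apply: eq_Rintegral => p _; rewrite Re_conjc.
rewrite -mulN1r -RintegralZl//; apply: eq_Rintegral => p _; rewrite Im_conjc; ring.
Qed.

(** The Bargmann space with measurability in place of holomorphy. Its elements are functions, not
    classes, so that evaluation at a point makes sense. *)
Definition L2 : set (R[i] -> R[i]) := [set f | cmeas f /\
  (\int[mu2]_p (normc (f (planec p)) ^+ 2 * gauss_weight (planec p))%:E < +oo)%E].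

Lemma weight_ge0 (z : R[i]) : 0 <= gauss_weight z.
Proof. exact: expR_ge0. Qed.

Lemma sqw_ge0 f z : 0 <= normc (f z) ^+ 2 * gauss_weight z.
Proof. by rewrite mulr_ge0 ?sqr_ge0 ?weight_ge0. Qed.

Lemma measurable_sqw f : cmeas f -> measurable_fun setT
  (fun p : mR * mR => normc (f (planec p)) ^+ 2 * gauss_weight (planec p) : mR).
Proof. by move=> mf; apply: measurable_funM; [exact: cmeas_normc2|exact: measurable_weight]. Qed.

Lemma L2_integrable f : L2 f -> mu2.-integrable setT
  (EFin \o (fun p => normc (f (planec p)) ^+ 2 * gauss_weight (planec p))).
Proof.
move=> [mf fi]; apply/integrableP; split; first by apply/measurable_EFinP; exact: measurable_sqw.
by under eq_integral do rewrite /= ger0_norm ?sqw_ge0//.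
Qed.

Lemma L2_dominated f (F : mR * mR -> R) : cmeas f ->
  mu2.-integrable setT (EFin \o F) ->
  (forall p, normc (f (planec p)) ^+ 2 * gauss_weight (planec p) <= F p) -> L2 f.
Proof.
move=> mf /integrableP[mF iF] fF; split => //.
apply: le_lt_trans iF; apply: ge0_le_integral => //.
- by move=> p _; rewrite lee_fin sqw_ge0.
- by apply/measurable_EFinP; exact: measurable_sqw.
- by apply: measurableT_comp mF.
- by move=> p _; rewrite /= lee_fin (le_trans (fF p)) ?ler_norm.
Qed.

Lemma cintegrable_dominated f (F : mR * mR -> R) : cmeas f ->
  mu2.-integrable setT (EFin \o F) ->
  (forall p, normc (f (planec p)) <= F p) -> cintegrable f.
Proof.
move=> [rf jf] iF fF; split; apply: (le_integrable measurableT _ _ iF).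
- exact/measurable_EFinP.
- by move=> p _; rewrite /= lee_fin (le_trans (Re_le_normc _))// (le_trans (fF p)) ?ler_norm.
- exact/measurable_EFinP.
- by move=> p _; rewrite /= lee_fin (le_trans (Im_le_normc _))// (le_trans (fF p)) ?ler_norm.
Qed.

(** Domination by |f|^2 + |g|^2, since |f g| is at most this sum. *)
Lemma L2_cintegrable f g : L2 f -> L2 g ->
  cintegrable (fun z => f z * conjc (g z) * (gauss_weight z)%:C).
Proof.
move=> Lf Lg; apply: (cintegrable_dominated _ (integrable_add (L2_integrable Lf) (L2_integrable Lg))).
  by apply: cmeasM; [apply: cmeasM; [exact: Lf.1|exact: (cmeas_conj Lg.1)]|exact: cmeas_weight].
move=> p; rewrite !Normc.normcM normc_conj normcR (ger0_norm (weight_ge0 _)) -mulrDl.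
rewrite ler_wpM2r ?weight_ge0//.
set a := normc _; set b := normc _.
have := sqr_ge0 (a - b); have := sqr_ge0 a; have := sqr_ge0 b; rewrite sqrrB; lra.
Qed.

Lemma L2_subspace : is_subspace L2.
Proof.
split.
- split; first exact: cmeas_cst.
  rewrite (eq_integral (fun=> 0%E)) ?integral0 ?ltry// => p _.
  by rewrite Normc.normc0 expr0n mul0r.
- move=> f g Lf Lg.
  apply: (L2_dominated _ (integrable_scale 2 (integrable_add (L2_integrable Lf) (L2_integrable Lg)))).
    exact: cmeasD Lf.1 Lg.1.
  move=> p; rewrite -mulrDl mulrA ler_wpM2r ?weight_ge0//.
  apply: (@le_trans _ _ ((normc (f (planec p)) + normc (g (planec p))) ^+ 2)).
    by rewrite ler_sqr ?nnegrE ?addr_ge0 ?normc_ge0// ler_normcD.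
  set a := normc _; set b := normc _.
  have := sqr_ge0 (a - b); rewrite sqrrB sqrrD; lra.
- move=> a f Lf.
  apply: (L2_dominated _ (integrable_scale (normc a ^+ 2) (L2_integrable Lf))).
    exact: cmeasM (cmeas_cst a) Lf.1.
  by move=> p; rewrite Normc.normcM exprMn -mulrA lexx.
Qed.

Lemma bargmann_ip_diag f : L2 f -> bargmann_ip f f =
  (pi^-1 * \int[mu2]_p (normc (f (planec p)) ^+ 2 * gauss_weight (planec p)))%:C.
Proof.
move=> Lf; rewrite /bargmann_ip plane_integralE.
have E z : f z * conjc (f z) * (gauss_weight z)%:C = (normc (f z) ^+ 2 * gauss_weight z)%:C.
  by rewrite mulc_conj [in RHS]rmorphM.
under eq_Rintegral do rewrite E /=.
under [X in _ +i* X]eq_Rintegral do rewrite E /=.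
by rewrite Rintegral_cst// mul0r; simpc.
Qed.

Lemma bargmann_semi_ip : is_semi_inner_product L2 (@bargmann_ip R).
Proof.
split.
- move=> f g h Lf Lg Lh; rewrite /bargmann_ip -mulrDr.
  rewrite -(plane_integralD (L2_cintegrable Lf Lh) (L2_cintegrable Lg Lh)).
  by congr (_ * plane_integral _); apply/funext => z; ring.
- move=> a f h Lf Lh; rewrite /bargmann_ip mulrCA -(plane_integralZ a (L2_cintegrable Lf Lh)).
  by congr (_ * plane_integral _); apply/funext => z; ring.
- move=> f g Lf Lg; rewrite /bargmann_ip conjcM -(plane_integral_conj (L2_cintegrable Lf Lg)).
  rewrite conjcR; congr (_ * plane_integral _).
  apply/funext => z; rewrite !conjcM conjcK conjcR; ring.
- move=> f Lf; rewrite bargmann_ip_diag// lecR mulr_ge0 ?invr_ge0 ?pi_ge0//.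
  by apply: Rintegral_ge0 => p _; exact: sqw_ge0.
Qed.

Lemma ip_norm_L2 f : L2 f -> ip_norm (@bargmann_ip R) f =
  Num.sqrt (pi^-1 * \int[mu2]_p (normc (f (planec p)) ^+ 2 * gauss_weight (planec p))).
Proof. by move=> Lf; rewrite /ip_norm bargmann_ip_diag. Qed.

Lemma ip_norm_mono f g : L2 f -> L2 g -> (forall z, normc (f z) <= normc (g z)) ->
  ip_norm (@bargmann_ip R) f <= ip_norm (@bargmann_ip R) g.
Proof.
move=> Lf Lg fg; rewrite !ip_norm_L2// ler_wsqrtr// ler_wpM2l ?invr_ge0 ?pi_ge0//.
apply: le_Rintegral => //; [exact: L2_integrable|exact: L2_integrable|].
by move=> p _; rewrite ler_wpM2r ?weight_ge0// ler_sqr ?nnegrE ?normc_ge0.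
Qed.

Lemma bargmannE f : bargmann f <-> entire f /\ L2 f.
Proof.
split=> [[ef fi]|[ef [_ fi]]]; split => //.
by split; [exact: cmeas_entire|].
Qed.

(** Membership test for the kernels: the Gaussian absorbs exponential growth. Domination by
    translates of the weight reduces this to the integrability of the weight itself. *)
Lemma L2_exp f (C c : R) : cmeas f ->
  (forall z, normc (f z) <= C * expR (c * normc z)) -> 0 <= c -> L2 f.
Proof.
move=> mf fC c0.
have C0 : 0 <= C.
  have := fC 0; rewrite Normc.normc0 mulr0 expR0 mulr1; apply: le_trans; exact: normc_ge0.
pose W (a b : R) (p : mR * mR) : R := gauss_weight (planec (p.1 + a, p.2 + b)).
have iW a b : mu2.-integrable setT (EFin \o W a b).
  exact: (integrable_area_preserving (area_preserving_translation a b) (integrable_weight R)).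
(* Completing the square: e^(2 c^2) times the weight translated by (a, b), with a and b equal to c
   or -c, is e^(-2 a x - 2 b y) times the weight. The four sign choices together dominate e^(2 c
   |x|) e^(2 c |y|). *)
pose F (p : mR * mR) := C ^+ 2 * expR (2 * c ^+ 2) *
  ((W c c p + W c (- c) p) + (W (- c) c p + W (- c) (- c) p)).
apply: (@L2_dominated f F) => //.
  by apply: integrable_scale; apply: integrable_add; exact: integrable_add.
move=> [x y]; rewrite /F /W /= !gauss_weightE /=; set z := planec (x, y).
have e1 (t : R) : expR (2 * c * `|t|) <= expR (2 * c * t) + expR (- (2 * c * t)).
  have [t0|t0] := leP 0 t; first by rewrite (ger0_norm t0) lerDl expR_ge0.
    by rewrite (ltr0_norm t0) mulrN lerDr expR_ge0.
have e2 : normc (f z) ^+ 2 <= C ^+ 2 * (expR (2 * c * `|x|) * expR (2 * c * `|y|)).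
  apply: (@le_trans _ _ ((C * expR (c * normc z)) ^+ 2)).
    by rewrite ler_sqr ?nnegrE ?mulr_ge0 ?normc_ge0 ?expR_ge0.
  rewrite exprMn ler_wpM2l ?sqr_ge0// -expRM_natl -expRD ler_expR.
  have := ler_wpM2l c0 (normc_le_ReIm z); rewrite /=; lra.
apply: (le_trans (ler_wpM2r (expR_ge0 _) e2)).
have e3 : expR (2 * c * `|x|) * expR (2 * c * `|y|) <=
    (expR (2 * c * x) + expR (- (2 * c * x))) * (expR (2 * c * y) + expR (- (2 * c * y))).
  by rewrite ler_pM ?expR_ge0.
rewrite -[leLHS]mulrA -[leRHS]mulrA ler_wpM2l ?sqr_ge0//.
apply: (le_trans (ler_wpM2r (expR_ge0 _) e3)).
have K (a b : R) : a ^+ 2 = c ^+ 2 -> b ^+ 2 = c ^+ 2 ->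
    expR (2 * c ^+ 2) * expR (- ((x + a) ^+ 2 + (y + b) ^+ 2)) =
    expR (- (2 * a * x)) * expR (- (2 * b * y)) * expR (- (x ^+ 2 + y ^+ 2)).
  move=> ac bc; rewrite -!expRD; congr expR.
  have -> : 2 * c ^+ 2 = a ^+ 2 + b ^+ 2 by rewrite ac bc; ring.
  ring.
have cN : (- c) ^+ 2 = c ^+ 2 by rewrite sqrrN.
have NN (t : R) : - (2 * - c * t) = 2 * c * t by ring.
rewrite [leRHS]mulrDr ![in leRHS]mulrDr !K// !NN le_eqVlt; apply/orP; left; apply/eqP.
ring.
Qed.

End GaussianL2.

(** * The reproducing kernel *)

Section Kernel.
Variable R : realType.
Local Notation mu := (@lebesgue_measure R).
Local Notation mR := (measurableTypeR R).
Local Notation mu2 := (mu \x mu)%E.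
Local Notation ip := (@bargmann_ip R).
Local Notation N := (ip_norm ip).
Implicit Types (f g : R[i] -> R[i]) (w h z : R[i]).

(** The base point comes first, so that [fock_kernel w] is the function K(., w). *)
Definition fock_kernel w z : R[i] := cexp (z * conjc w).

Lemma entire_kernel w : entire (fock_kernel w).
Proof.
exact: (@entire_comp R (@cexp R) (fun z => z * conjc w) (@entire_cexp R)
  (entireM (@entire_id R) (@entire_cst R (conjc w)))).
Qed.

Arguments entire_kernel : clear implicits.

Lemma normc_kernel_le w z : normc (fock_kernel w z) <= expR (normc w * normc z).
Proof.
rewrite normc_cexp ler_expR (le_trans (ler_norm _))// (le_trans (Re_le_normc _))//.
by rewrite Normc.normcM normc_conj mulrC.
Qed.

Lemma normc_le_exp z : normc z <= expR (normc z).
Proof. by have := expR_ge1Dx (normc z); lra. Qed.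

Lemma L2_kernel w : L2 (fock_kernel w).
Proof.
apply: (@L2_exp R (fock_kernel w) 1 (normc w)).
  - exact: (cmeas_entire (entire_kernel w)).
- by move=> z; rewrite mul1r normc_kernel_le.
- exact: normc_ge0.
Qed.

(** This is the derivative of the kernel in conj w; pairing with it gives the derivative at w of a
    reproduced function. *)
Lemma L2_mul_kernel w : L2 (fun z => z * fock_kernel w z).
Proof.
apply: (@L2_exp R (fun z => z * fock_kernel w z) 1 (1 + normc w)).
- exact: (cmeas_entire (entireM (@entire_id R) (entire_kernel w))).
- move=> z; rewrite mul1r Normc.normcM mulrDl mul1r expRD.
  by rewrite ler_pM ?normc_ge0// ?normc_le_exp ?normc_kernel_le.
- by rewrite addr_ge0// normc_ge0.
Qed.

(** Embedded in R[i] so that [L2] and [ip_norm] apply to it as a majorant of kernel increments. *)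
Definition exp_bound (c : R) z : R[i] := (expR (c * normc z))%:C.

Lemma L2_exp_bound (c : R) : 0 <= c -> L2 (exp_bound c).
Proof.
move=> c0; apply: (@L2_exp R (exp_bound c) 1 c) => //.
  split; last exact: measurable_cst.
  apply: measurableT_comp => //; apply: measurable_funM => //.
  rewrite [X in measurable_fun _ X](_ : _ = fun p => Num.sqrt (normc (planec p) ^+ 2)); last first.
    by apply/funext => p; rewrite sqrtr_sqr ger0_norm// normc_ge0.
  apply: (measurableT_comp (continuous_measurable_fun (@sqrt_continuous R))).
  exact: (cmeas_normc2 (cmeas_entire (@entire_id R))).
by move=> z; rewrite mul1r normcR ger0_norm ?expR_ge0.
Qed.

(** Taylor remainder of the kernel in h, with |h|^2 split off from a majorant independent of h. The
    3 is 2 + 1: |z|^2 <= e^(2 |z|), and e^(|h| |z|) <= e^|z| as |h| <= 1. *)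
Lemma kernel_increment_le w h z : normc h <= 1 ->
  normc (fock_kernel (w + h) z - fock_kernel w z - conjc h * (z * fock_kernel w z))
  <= 4 * normc h ^+ 2 * expR ((normc w + 3) * normc z).
Proof.
move=> h1; pose zh := z * conjc h.
have -> : fock_kernel (w + h) z - fock_kernel w z - conjc h * (z * fock_kernel w z)
    = fock_kernel w z * (cexp zh - 1 - zh).
  by rewrite /fock_kernel rmorphD mulrDr cexpD /zh; ring.
rewrite Normc.normcM.
have nzh : normc zh = normc h * normc z by rewrite Normc.normcM normc_conj mulrC.
have nz0 := normc_ge0 z; have nh0 := normc_ge0 h.
have e1 : normc (cexp zh - 1 - zh) <= 4 * normc h ^+ 2 * (normc z ^+ 2 * expR (normc z)).
  apply: (le_trans (cexp_sub1z_le _)); rewrite nzh.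
  have -> : 4 * (normc h * normc z) ^+ 2 * expR (normc h * normc z)
      = 4 * normc h ^+ 2 * (normc z ^+ 2 * expR (normc h * normc z)) by ring.
  rewrite ler_wpM2l ?mulr_ge0 ?sqr_ge0// ler_wpM2l ?sqr_ge0// ler_expR.
  exact: ler_piMl.
have e2 : normc z ^+ 2 <= expR (2 * normc z).
  by rewrite expRM_natl ler_sqr ?nnegrE ?expR_ge0// normc_le_exp.
apply: (le_trans (ler_pM (normc_ge0 _) (normc_ge0 _) (normc_kernel_le w z) e1)).
rewrite mulrCA ler_wpM2l ?mulr_ge0 ?sqr_ge0//.
have -> : (normc w + 3) * normc z = normc w * normc z + (2 * normc z + normc z) by ring.
by rewrite !expRD ler_wpM2l ?expR_ge0// ler_wpM2r ?expR_ge0.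
Qed.

(** The pairing is conjugate linear in its second argument, so the first-order term
    [conjc h * (z * fock_kernel w z)] contributes h times a constant, the derivative; Cauchy-Schwarz
    makes the rest quadratic in h. *)
Lemma L2_reproduced_entire F : L2 F -> (forall w, F w = ip F (fock_kernel w)) ->
  entire F.
Proof.
move=> LF FE w; apply: (@cdiff_derivable R F w (ip F (fun z => z * fock_kernel w z))) => e e0.
have sL := L2_subspace R; have sI := bargmann_semi_ip R.
pose c := normc w + 3.
have c0 : 0 <= c by rewrite addr_ge0// normc_ge0.
have LG := L2_exp_bound c0.
pose A := N F * N (exp_bound c).
have A0 : 0 <= A by rewrite mulr_ge0// ip_norm_ge0.
(* 8 = 2 * 4: the factor 2 of [sip_cauchy_schwarz] and the 4 of [kernel_increment_le]; the added 1
   allows division. *)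
have A1 : 0 < 8 * A + 1 by rewrite ltr_wpDl// mulr_ge0.
exists (Num.min 1 (e / (8 * A + 1))); first by rewrite lt_min ltr01 divr_gt0.
move=> h; rewrite lt_min => /andP[h1 h2].
have L1 := L2_kernel (w + h); have L0 := L2_kernel w; have Ld := L2_mul_kernel w.
have Lhd := subspaceZ sL (conjc h) Ld.
pose E z := fock_kernel (w + h) z - fock_kernel w z - conjc h * (z * fock_kernel w z).
have LE : L2 E by exact: (subspaceB sL (subspaceB sL L1 L0) Lhd).
have -> : F (w + h) - F w - ip F (fun z => z * fock_kernel w z) * h = ip F E.
  rewrite (sip_Br sL sI (subspaceB sL L1 L0) Lhd LF) (sip_Br sL sI L1 L0 LF).
  by rewrite (sip_Zr sL sI _ Ld LF) conjcK -!FE mulrC.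
apply: (le_trans (sip_cauchy_schwarz sL sI LF LE)).
have nE : N E <= 4 * normc h ^+ 2 * N (exp_bound c).
  have LG' := subspaceZ sL ((4 * normc h ^+ 2)%:C) LG.
  have h0 : 0 <= 4 * normc h ^+ 2 by rewrite mulr_ge0// sqr_ge0.
  apply: (le_trans (ip_norm_mono LE LG' _)).
    move=> z; rewrite Normc.normcM !normcR !ger0_norm ?expR_ge0//.
    exact: (kernel_increment_le w z (ltW h1)).
  by rewrite (ip_normZ sL sI _ LG) normcR ger0_norm.
apply: (@le_trans _ _ (8 * A * normc h * normc h)).
  have -> : 8 * A * normc h * normc h = 2 * (N F * (4 * normc h ^+ 2 * N (exp_bound c))).
    by rewrite /A; ring.
  by rewrite ler_pM2l// ler_wpM2l// ip_norm_ge0.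
rewrite ler_wpM2r ?normc_ge0//.
apply: (@le_trans _ _ ((8 * A + 1) * normc h)).
  by rewrite ler_wpM2r ?normc_ge0// lerDl.
by rewrite mulrC -ler_pdivlMr// ltW.
Qed.

Lemma weight_cexp z : (gauss_weight z)%:C = cexp (- (z * conjc z)).
Proof.
by rewrite mulc_conj /cexp /= oppr0 cos0 sin0 mulr1 mulr0.
Qed.

Lemma bargmann_reproducing f w : bargmann f -> f w = ip f (fock_kernel w).
Proof.
move=> /bargmannE[ef Lf]; rewrite /bargmann_ip.
set F := (X in plane_integral X).
have cF : cintegrable F := L2_cintegrable Lf (L2_kernel w).
pose g u := f (u + w) * cexp (u * (- conjc w)).
have eg : entire g.
  apply: entireM.
    exact: (@entire_comp R f (fun u => u + w) ef (entireD (@entire_id R) (@entire_cst R w))).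
  exact: (@entire_comp R (@cexp R) (fun u => u * (- conjc w)) (@entire_cexp R)
     (entireM (@entire_id R) (@entire_cst R (- conjc w)))).
have g0 : g 0 = f w by rewrite /g add0r mul0r cexp0 mulr1.
(* Equality of exponents: conj(u + w) w - (u + w) conj(u + w) = -u conj w - u conj u. *)
have FE u : F (u + w) = g u * (gauss_weight u)%:C.
  rewrite /F /g !weight_cexp /fock_kernel conj_cexp -!mulrA -!cexpD.
  congr (_ * cexp _); rewrite !rmorphD /= !rmorphM /= conjcK; ring.
have mg := gaussian_mean_Re eg; have mgN := gaussian_mean_Re (entireN_imul eg).
clear ef eg.
have pT := area_preserving_translation (complex.Re w) (complex.Im w).
have pw (p : mR * mR) : planec (p.1 + complex.Re w, p.2 + complex.Im w) = planec p + w.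
  by rewrite /planec; case: (w) => a b; simpc.
have ReF u : complex.Re (F (u + w)) = complex.Re (g u) * gauss_weight u.
  by rewrite FE ReM /= mulr0 subr0.
have ImF u : complex.Im (F (u + w)) = complex.Re ((0 +i* (-1)) * g u) * gauss_weight u.
  by rewrite FE ImM Re_Nimul /= mulr0 add0r.
have piN0 : pi != 0 :> R by rewrite gt_eqF// pi_gt0.
(* Stated once for real and imaginary parts. The integrability that the Gaussian mean asks for is
   carried over by translation from that of f times the conjugate kernel. *)
have key (G : R[i] -> R) (H : R[i] -> R) (v : R) :
    (forall u, G (u + w) = H u * gauss_weight u) ->
    mu2.-integrable setT (EFin \o (fun p => G (planec p))) ->
    (mu2.-integrable setT (EFin \o (fun p => H (planec p) * gauss_weight (planec p))) ->
     (\int[mu2]_p (H (planec p) * gauss_weight (planec p))%:E = (pi * v)%:E)%E) ->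
    \int[mu2]_p G (planec p) = pi * v.
  move=> GH iG HH.
  have E : (fun p => G (planec p)) \o (fun p : mR * mR => (p.1 + complex.Re w, p.2 + complex.Im w))
     = (fun p => H (planec p) * gauss_weight (planec p)).
    by apply/funext => p /=; rewrite pw GH.
  have := integral_area_preserving pT iG; have := integrable_area_preserving pT iG.
  rewrite E => /HH HI; rewrite /Rintegral => <-.
  by under eq_integral do rewrite pw GH; rewrite HI.
have KR := key (fun z => complex.Re (F z)) (fun z => complex.Re (g z)) _ ReF cF.1 mg.
have KI := key (fun z => complex.Im (F z)) (fun z => complex.Re ((0 +i* (-1)) * g z)) _ ImF cF.2 mgN.
rewrite plane_integralE KR KI g0 Re_Nimul.
by simpc; rewrite !mulrA mulVf// !mul1r; case: (f w).
Qed.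

End Kernel.

(** * Completeness *)

Section Completeness.
Variable R : realType.
Local Notation mu := (@lebesgue_measure R).
Local Notation mR := (measurableTypeR R).
Local Notation mu2 := (mu \x mu)%E.
Local Notation ip := (@bargmann_ip R).
Local Notation N := (ip_norm ip).
Implicit Types (f g : R[i] -> R[i]) (w h z : R[i]).

Lemma integral_sqw f : L2 f ->
  (\int[mu2]_p (normc (f (planec p)) ^+ 2 * gauss_weight (planec p))%:E
   = (pi * N f ^+ 2)%:E)%E.
Proof.
move=> Lf; rewrite ip_norm_L2// sqr_sqrtr; last first.
  rewrite mulr_ge0 ?invr_ge0 ?pi_ge0//.
  by apply: Rintegral_ge0 => p _; exact: sqw_ge0.
rewrite mulrA divff ?mul1r; last by rewrite gt_eqF// pi_gt0.
rewrite /Rintegral fineK//; exact: (integrable_fin_num measurableT (L2_integrable Lf)).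
Qed.

Lemma L2_of_integral_le f (e : R) : 0 <= e -> cmeas f ->
  (\int[mu2]_p (normc (f (planec p)) ^+ 2 * gauss_weight (planec p))%:E
   <= (pi * e ^+ 2)%:E)%E -> L2 f /\ N f <= e.
Proof.
move=> e0 mf fe; have Lf : L2 f by split => //; rewrite (le_lt_trans fe)// ltry.
split => //; move: fe; rewrite integral_sqw// lee_fin ler_pM2l ?pi_gt0//.
by rewrite ler_sqr ?nnegrE ?ip_norm_ge0.
Qed.

Lemma real_cauchy_cvg (a : nat -> R) :
  (forall e : R, 0 < e -> exists n0 : nat, forall m n : nat,
    (n0 <= m)%N -> (n0 <= n)%N -> `|a m - a n| < e) ->
  exists l : R, a @ \oo --> l.
Proof.
move=> ca; have : cvg (a @ \oo).
  apply/cauchy_cvgP; apply: cauchy_exP => e e0.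
  have [n0 hn0] := ca e e0; exists (a n0); exists n0 => // n /= n0n.
  by rewrite /ball /=; exact: hn0.
by move=> ac; exists (lim (a @ \oo)).
Qed.

Lemma ler_dist_normc w z : `|normc w - normc z| <= normc (w - z).
Proof.
rewrite ler_norml; apply/andP; split.
  have := ler_normcD (z - w) w; rewrite subrK (normcB z w); lra.
have := ler_normcD (w - z) z; rewrite subrK; lra.
Qed.

Lemma limn_einf_le (a : nat -> \bar R) (B : \bar R) :
  (forall n, a n <= B)%E -> (limn_einf a <= B)%E.
Proof.
move=> aB; rewrite limn_einf_lim; apply: lime_le; first exact: is_cvg_einfs.
apply: nearW => n; rewrite /einfs /=; apply: ge_ereal_inf; exists (a n) => //.
by exists n => /=.
Qed.

Lemma bargmann_L2 f : bargmann f -> L2 f.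
Proof. by move=> /bargmannE[]. Qed.

Lemma bargmann_subspace : is_subspace (@bargmann R).
Proof.
have sL := L2_subspace R; split.
- by apply/bargmannE; split; [exact: entire_cst|exact: (subspace0 sL)].
- move=> f g /bargmannE[ef Lf] /bargmannE[eg Lg]; apply/bargmannE.
  by split; [exact: (entireD ef eg)|exact: (subspaceD sL Lf Lg)].
- move=> a f /bargmannE[ef Lf]; apply/bargmannE.
  by split; [exact: (entireM (@entire_cst R a) ef)|exact: (subspaceZ sL a Lf)].
Qed.

Lemma bargmann_kernel w : bargmann (fock_kernel w).
Proof. by apply/bargmannE; split; [exact: entire_kernel|exact: L2_kernel]. Qed.

Lemma bargmann_eval_le f z : bargmann f ->
  normc (f z) <= 2 * N (fock_kernel z) * N f.
Proof.
move=> Bf; rewrite {1}(bargmann_reproducing z Bf).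
have -> : 2 * N (fock_kernel z) * N f = 2 * (N f * N (fock_kernel z)) by ring.
exact: (sip_cauchy_schwarz (L2_subspace R) (bargmann_semi_ip R) (bargmann_L2 Bf) (L2_kernel z)).
Qed.

Lemma bargmann_inner_product : is_inner_product (@bargmann R) ip.
Proof.
have sI := bargmann_semi_ip R; split.
- move=> f g h /bargmann_L2 Lf /bargmann_L2 Lg /bargmann_L2 Lh.
  exact: (sip_Dl sI Lf Lg Lh).
- by move=> a f h /bargmann_L2 Lf /bargmann_L2 Lh; exact: (sip_Zl sI a Lf Lh).
- by move=> f g /bargmann_L2 Lf /bargmann_L2 Lg; exact: (sip_herm sI Lf Lg).
- by move=> f /bargmann_L2 Lf; exact: (sip_ge0 sI Lf).
(* Definiteness follows from the evaluation bound: norm 0 forces the value 0 at every point. *)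
- move=> f Bf f0; have N0 : N f = 0 by rewrite /ip_norm f0 sqrtr0.
  apply/funext => z; have := bargmann_eval_le z Bf; rewrite N0 mulr0 => fz.
  by apply: Normc.eq0_normc; apply/eqP; rewrite eq_le fz normc_ge0.
Qed.

Lemma bargmann_complete : ip_complete (@bargmann R) ip.
Proof.
move=> u Bu cu; have sL := L2_subspace R; have sI := bargmann_semi_ip R.
have Lu n : L2 (u n) := bargmann_L2 (Bu n).
have Bd m n : bargmann (fun x => u m x - u n x) := subspaceB bargmann_subspace (Bu m) (Bu n).
have cz z e : 0 < e -> exists n0 : nat, forall m n : nat,
    (n0 <= m)%N -> (n0 <= n)%N -> normc (u m z - u n z) < e.
  move=> e0; pose K := 2 * N (fock_kernel z).
  have K0 : 0 <= K by rewrite mulr_ge0// ip_norm_ge0.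
  have K1 : 0 < K + 1 by rewrite ltr_wpDl.
  have [n0 hn0] := cu (e / (K + 1)) (divr_gt0 e0 K1).
  exists n0 => m n hm hn; apply: (le_lt_trans (bargmann_eval_le z (Bd m n))).
  apply: (@le_lt_trans _ _ ((K + 1) * N (fun x => u m x - u n x))).
    by rewrite ler_wpM2r ?ip_norm_ge0// lerDl.
  by rewrite mulrC -ltr_pdivlMr//; exact: hn0.
have lRe z : exists l : R, (fun n => complex.Re (u n z)) @ \oo --> l.
  apply: real_cauchy_cvg => e /(cz z)[n0 hn0]; exists n0 => m n hm hn.
  by rewrite -ReB (le_lt_trans (Re_le_normc _))// hn0.
have lIm z : exists l : R, (fun n => complex.Im (u n z)) @ \oo --> l.
  apply: real_cauchy_cvg => e /(cz z)[n0 hn0]; exists n0 => m n hm hn.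
  by rewrite -ImB (le_lt_trans (Im_le_normc _))// hn0.
have [fr hfr] := choice lRe; have [fi hfi] := choice lIm.
pose f z := fr z +i* fi z.
have cf z e : 0 < e -> \forall n \near \oo, normc (u n z - f z) < e.
  move=> e0; have e2 : 0 < e / 2 by rewrite divr_gt0.
  near=> n; apply: (le_lt_trans (normc_le_ReIm _)); rewrite ReB ImB /=.
  rewrite [e]splitr ltrD// distrC.
    by near: n; move/cvgrPdist_lt : (hfr z); exact.
  by near: n; move/cvgrPdist_lt : (hfi z); exact.
have mf : cmeas f.
  split.
    apply: (@measurable_fun_cvg _ _ _ _ (fun n p => complex.Re (u n (planec p)))).
      by move=> m; exact: (Lu m).1.1.
    by move=> p _; exact: hfr.
  apply: (@measurable_fun_cvg _ _ _ _ (fun n p => complex.Im (u n (planec p)))).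
    by move=> m; exact: (Lu m).1.2.
  by move=> p _; exact: hfi.
have mN g : cmeas g -> cmeas (fun z => - g z).
  move=> mg; have := cmeasM (@cmeas_cst R (-1)) mg.
  by under eq_fun do rewrite mulN1r.
have close (e : R) : 0 < e -> exists n0 : nat, forall n, (n0 <= n)%N ->
    L2 (fun z => u n z - f z) /\ N (fun z => u n z - f z) <= e.
  move=> e0; have [n0 hn0] := cu e e0; exists n0 => n n0n.
  apply: L2_of_integral_le; [exact: ltW| |].
    exact: (cmeasD (Lu n).1 (mN _ mf)).
  (* Fatou is applied in m with n fixed; the shift by [n0] makes the Cauchy bound hold for every
     m. *)
  pose F m (p : mR * mR) : \bar R :=
    (normc (u n (planec p) - u (m + n0)%N (planec p)) ^+ 2 * gauss_weight (planec p))%:E.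
  have Ld m : L2 (fun z => u n z - u (m + n0)%N z) := bargmann_L2 (Bd n (m + n0)%N).
  (* The integrands converge pointwise in m, so the lower limit in Fatou's lemma is their limit. *)
  have FE p : limn_einf (F^~ p) =
      (normc (u n (planec p) - f (planec p)) ^+ 2 * gauss_weight (planec p))%:E.
    set l := (X in X%:E); suff h : F^~ p @ \oo --> l%:E by exact: (cvg_limn_einf_sup h).1.
    apply: cvg_EFin; first by apply: nearW.
    have nl : (fun m => normc (u n (planec p) - u (m + n0)%N (planec p))) @ \oo -->
        normc (u n (planec p) - f (planec p)).
      apply/cvgrPdist_lt => d d0; have [k _ hk] := cf (planec p) d d0.
      exists k => // m /= km; apply: (le_lt_trans (ler_dist_normc _ _)).
      have -> : u n (planec p) - f (planec p) - (u n (planec p) - u (m + n0)%N (planec p))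
         = u (m + n0)%N (planec p) - f (planec p) by ring.
      by apply: hk; rewrite /= (leq_trans km)// leq_addr.
    apply: cvgM; last exact: cvg_cst.
    by rewrite expr2; apply: cvgM.
  under eq_integral do rewrite -FE.
  apply: le_trans (fatou _ _ _ _) _ => //.
  - by move=> m; apply/measurable_EFinP; exact: (measurable_sqw (Ld m).1).
  - by move=> m p _; rewrite lee_fin (sqw_ge0 (fun z => u n z - u (m + n0)%N z)).
  - apply: limn_einf_le => m; rewrite [leLHS](integral_sqw (Ld m)).
    rewrite lee_fin ler_wpM2l ?pi_ge0// ler_sqr ?nnegrE ?ip_norm_ge0 ?(ltW e0)//.
    by rewrite ltW// hn0// leq_addl.
have Lf : L2 f.
  have [n0 /(_ n0 (leqnn _))[Ld _]] := close 1 ltr01.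
  have := subspaceB sL (Lu n0) Ld.
  by have -> : (fun x => u n0 x - (u n0 x - f x)) = f by apply/funext => x; ring.
have conv : ip_converges ip u f.
  apply/cvgrPdist_le => e e0; have [n0 hn0] := close e e0.
  exists n0 => // n /= n0n; rewrite sub0r normrN ger0_norm ?ip_norm_ge0//.
  by have [] := hn0 n n0n.
exists f => //; apply/bargmannE; split => //.
apply: (L2_reproduced_entire Lf) => w; apply/eqP; rewrite -subr_eq0.
apply/eqP/Normc.eq0_normc/eqP; rewrite eq_le normc_ge0 andbT.
apply/ler_addgt0Pl => e e0; rewrite addr0.
pose K := 2 * N (fock_kernel w).
have K0 : 0 <= K by rewrite mulr_ge0// ip_norm_ge0.
have K1 : 0 < K + 1 by rewrite ltr_wpDl.
have e2 : 0 < e / 2 by rewrite divr_gt0.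
have [n0 hn0] := close (e / 2 / (K + 1)) (divr_gt0 e2 K1).
have [n1 _ hn1] := cf w _ e2.
pose n := maxn n0 n1.
have [Ld Nd] := hn0 n (leq_maxl _ _); have hfn := hn1 n (leq_maxr n0 n1).
(* As [u n] is reproduced, the defect of f splits in two: pointwise convergence controls the
   evaluation and convergence in norm the pairing, each within e / 2. *)
have -> : f w - ip f (fock_kernel w) =
    - (u n w - f w) + ip (fun z => u n z - f z) (fock_kernel w).
  rewrite (sip_Bl sL sI (Lu n) Lf (L2_kernel w)) -(bargmann_reproducing w (Bu n)); ring.
apply: (le_trans (ler_normcD _ _)); rewrite normcN [e]splitr lerD//; first exact: ltW.
apply: (le_trans (sip_cauchy_schwarz sL sI Ld (L2_kernel w))).
rewrite mulrCA -/K; apply: (@le_trans _ _ (e / 2 / (K + 1) * (K + 1)));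
  last by rewrite divfK// gt_eqF.
apply: ler_pM => //; [exact: ip_norm_ge0|by rewrite lerDl].
Unshelve. all: by end_near. Qed.

End Completeness.

Theorem lemma2p22 (R : realType) :
  is_rkhs (@bargmann R) (@bargmann_ip R) /\
  is_reproducing_kernel (@bargmann R) (@bargmann_ip R)
    (fun z w : R[i] => cexp (z * conjc w)).
Proof.
split; last by move=> w; split=> [|f]; [exact: bargmann_kernel|exact: bargmann_reproducing].
split; last by move=> z; eexists => f; exact: bargmann_eval_le.
split; [exact: bargmann_subspace|exact: bargmann_inner_product|exact: bargmann_complete].
Qed.
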